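(* Let $n\geq 1$, let $H$ be any graph, and let $S=K[V(P_n\odot H)]$. Then $$\operatorname{reg}(S/I(P_n\odot H))=\begin{cases}\lceil\frac{n}{2}\rceil, & \text{if } H \text{ is a null graph};\\ n\cdot\operatorname{reg}(K[V(H)]/I(H)), & \text{otherwise}.\end{cases}$$
   Context: $K$ is a field. All graphs are finite, simple, have nonempty vertex set, and may have isolated vertices. Vertices of a graph $G$ are identified with the variables of the standard graded polynomial ring $K[V(G)]$. A null graph is a graph with no edges. Edge ideal convention: $I(G)\subset K[V(G)]$ is the ideal generated by all products $x_ix_j$ with $\{x_i,x_j\}\in E(G)$ together with all variables $x_k$ with $x_k$ an isolated vertex of $G$. (Thus $K[V(H)]/I(H)\cong K[V(H')]/I(H')$, where $H'$ is the induced subgraph of $H$ on the non-isolated vertices.) The corona product $X\odot H$ is the graph obtained from one copy of $X$ and $|V(X)|$ disjoint copies of $H$, namely $H_1,\dots,H_{|V(X)|}$, by joining the $i$-th vertex of $X$ to every vertex of $H_i$. It has no isolated vertices, so $I(X\odot H)$ is the usual edge ideal. $P_n$ is the path on $n$ vertices ($P_1$ is a single vertex). $\operatorname{reg}(A)=\max\{j-i:\beta_{i,j}(A)\neq0\}$ is the Castelnuovo–Mumford regularity, where $\beta_{i,j}(A)$ are the graded Betti numbers of the finitely generated graded module $A$ over the corresponding polynomial ring. *)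

(* Defs.v *)
From Stdlib Require Import ClassicalEpsilon.
From HB Require Import structures.
From mathcomp Require Import all_boot all_order all_algebra.
From mathcomp Require Import mpoly.

Set Implicit Arguments.
Unset Strict Implicit.
Unset Printing Implicit Defensive.

Import Order.TTheory GRing.Theory Num.Theory.
Local Open Scope ring_scope.

(* Finite simple graphs; nonemptiness of the vertex set is not part of the
   structure and has to be assumed separately. *)
Record sgraph := SGraph {
  vertex :> finType;
  adj : rel vertex;
  adj_sym : ssrbool.symmetric adj;
  adj_irr : irreflexive adj }.

Definition isolated (G : sgraph) (x : G) : bool := [forall y, ~~ adj x y].

Definition null_graph (G : sgraph) : bool :=
  [forall x : G, forall y : G, ~~ adj x y].

Definition path_adj (n : nat) : rel 'I_n :=
  fun i j => (i.+1 == j :> nat) || (j.+1 == i :> nat).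

Lemma path_adj_sym n : ssrbool.symmetric (@path_adj n).
Proof. by move=> i j; rewrite /path_adj orbC. Qed.

Lemma path_adj_irr n : irreflexive (@path_adj n).
Proof. by move=> i; rewrite /path_adj orbb gtn_eqF. Qed.

Definition path_graph (n : nat) : sgraph :=
  SGraph (@path_adj_sym n) (@path_adj_irr n).

(* [inl x] is the vertex x of X, and [inr (x, h)] is the vertex h of the copy
   of H attached to x. *)
Definition corona_adj (X H : sgraph) : rel (X + X * H)%type :=
  fun u v => match u, v with
  | inl x, inl y => adj x y
  | inl x, inr (y, _) => x == y
  | inr (x, _), inl y => x == y
  | inr (x, h), inr (y, k) => (x == y) && adj h k
  end.

Lemma corona_adj_sym X H : ssrbool.symmetric (@corona_adj X H).
Proof.
by move=> [x|[x h]] [y|[y k]] //=; rewrite ?[y == x]eq_sym // adj_sym.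
Qed.

Lemma corona_adj_irr X H : irreflexive (@corona_adj X H).
Proof. by move=> [x|[x h]] /=; rewrite adj_irr ?andbF. Qed.

Definition corona (X H : sgraph) : sgraph :=
  SGraph (@corona_adj_sym X H) (@corona_adj_irr X H).

Section Regularity.
Variables (K : fieldType) (n : nat).
Local Notation S := {mpoly K[n]}.

Definition ideal_gen (A : S -> Prop) (p : S) : Prop :=
  exists s : seq (S * S),
    (forall u, u \in s -> A u.2) /\ p = \sum_(u <- s) u.1 * u.2.

(* Data of an augmented sequence ... -> F_1 -> F_0 -> S/I with F_i the direct
   sum of the S(- gr_deg i k), k < gr_rank i.  Elements of F_i are row vectors,
   and [gr_diff i] is the matrix of the map F_(i+1) -> F_i, v |-> v *m _.
   [gr_aug] lists lifts to S of the images in S/I of the basis of F_0. *)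
Record gr_free_data := GrFreeData {
  gr_rank : nat -> nat;
  gr_deg : forall i : nat, 'I_(gr_rank i) -> int;
  gr_diff : forall i : nat, 'M[S]_(gr_rank i.+1, gr_rank i);
  gr_aug : 'cV[S]_(gr_rank 0) }.

(* All monomials of p have degree d; forces p = 0 when d < 0. *)
Definition homog_of_deg (d : int) (p : S) : Prop :=
  forall m : 'X_{1..n}, m \in msupp p -> (mdeg m)%:Z = d.

Definition gr_free_resolution (I : S -> Prop) (F : gr_free_data) : Prop :=
  [/\ (forall k, homog_of_deg (gr_deg k) (gr_aug F k 0))
      /\ (forall i k l,
            homog_of_deg (gr_deg k - gr_deg l) (gr_diff F i k l)),
      forall p : S, exists v : 'rV[S]_(gr_rank F 0),
        I (p - (v *m gr_aug F) 0 0),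
      forall v : 'rV[S]_(gr_rank F 0),
        I ((v *m gr_aug F) 0 0) <-> exists w, v = w *m gr_diff F 0
    & forall i (v : 'rV[S]_(gr_rank F i.+1)),
        v *m gr_diff F i = 0 <-> exists w, v = w *m gr_diff F i.+1].

(* The image of each differential lies in (x_1, ..., x_n) F_i. *)
Definition gr_minimal (F : gr_free_data) : Prop :=
  forall i k l, (gr_diff F i k l)@_0%MM = 0.

(* The graded Betti number beta_(i,j)(S/I): the number of summands S(-j) in
   the i-th module of a minimal graded free resolution of S/I.  Such a
   resolution exists and is unique up to isomorphism for I homogeneous; the
   value is meaningless for other I. *)
Definition betti (I : S -> Prop) (i : nat) (j : int) : nat :=
  epsilon (inhabits 0%N) (fun b : nat =>
    exists F : gr_free_data,
      [/\ gr_free_resolution I F, gr_minimal F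
        & b = #|[set k : 'I_(gr_rank F i) | gr_deg k == j]|]).

(* reg(S/I), for a proper homogeneous ideal I of S. *)
Definition reg_quot (I : S -> Prop) : int :=
  epsilon (inhabits (0 : int)) (fun r : int =>
    (exists (i : nat) (j : int), betti I i j <> 0%N /\ r = j - i%:Z)
    /\ forall (i : nat) (j : int), betti I i j <> 0%N -> j - i%:Z <= r).

End Regularity.

(* The variable of K[V(G)] attached to x. *)
Definition vvar (K : fieldType) (G : sgraph) (x : G) : {mpoly K[#|G|]} :=
  'X_(enum_rank x).

(* Besides the edge monomials, isolated vertices are generators too. *)
Definition edge_ideal (K : fieldType) (G : sgraph) :
    {mpoly K[#|G|]} -> Prop :=
  ideal_gen (fun p : {mpoly K[#|G|]} =>
    (exists x y : G, adj x y /\ p = vvar K x * vvar K y)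
    \/ (exists x : G, isolated x /\ p = vvar K x)).

(* Main.v *)
Require Import Defs.
From Stdlib Require Import ClassicalEpsilon.
From HB Require Import structures.
From mathcomp Require Import all_boot all_order all_algebra.
From mathcomp Require Import mpoly ring zify.

Set Implicit Arguments.
Unset Strict Implicit.
Unset Printing Implicit Defensive.

Import Order.TTheory GRing.Theory Num.Theory.
Local Open Scope ring_scope.

(** By Hochster's formula, the graded Betti number of a face ring in
    homological degree i and degree j vanishes if and only if, for every set A
    of j variables, the induced subcomplex on A has no reduced cohomology in
    dimension j - i - 1, that is, on faces of size j - i.  The regularity of
    K[V(G)]/I(G) is therefore the largest size q at which some induced
    independence complex of G has cohomology ([reg_edge_ideal]).  An induced
    subgraph with an isolated vertex has a cone as independence complex, so
    the variables among the generators of I(G) do not change this number.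

    Hochster's formula is reached through Koszul homology.  Exactness of
    the Koszul complex of S shifts the Koszul homology of one module of a minimal
    free resolution, modulo its relations, to that of the next
    ([koszul_acyclic_syzygies]); after i shifts, the i-th Koszul homology of
    S/I in degree d becomes the space of generators of degree d in the i-th
    free module.  Any two minimal resolutions thus have generators in the same
    degrees ([resolution_degreeP]).  On the other hand the Koszul complex of a
    face ring is multigraded, and in each multidegree it is the cochain complex
    of a simplicial complex, a cone when the multidegree is not squarefree
    ([koszul_acyclic_face]).  The same description shows that Koszul homology
    lives in degrees at most the number of variables.  Hence each module of
    relations is generated in bounded degrees, and a minimal resolution exists
    ([face_resolution]).

    Two facts about cohomology of independence complexes then give the theorem.
    - Deleting a vertex x, or deleting x with its neighbours at the price of one
      more unit, bounds the regularity ([reg_le_del_link]); this is the exact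
      sequence of the deletion and the link of x.
    - Over a field the bound of a disjoint union is the sum of the bounds, and
      nonzero classes multiply ([reg_le_join], [not_acyclic_join]); this is the
      Künneth formula for joins.

    If H has an edge, its regularity r is positive.  Removing the vertices of
    the path one at a time, each link loses a copy of H, hence r >= 1 units, and
    pays only one; so the bound n r of n disjoint copies of H survives.
    The copies themselves form an induced subgraph, whence equality.  This works
    for any graph in place of the path ([reg_corona_edge]).  If H is null, the
    link of the last vertex of the path removes two vertices of the path, which
    gives the bound uphalf n; the whiskers at every other vertex of the path form
    an induced matching which attains it ([reg_whiskered_path]). *)

(** * Cohomology of a simplicial complex *)

(** This is the reason why two consecutive differentials compose to zero.  The
    vanishing diagonal is a separate hypothesis so that characteristic two is
    covered. *)
Lemma sum_antisym (T : finType) (V : zmodType) (a : T -> T -> V) :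
  (forall k, a k k = 0) -> (forall k l, k != l -> a k l = - a l k) ->
  \sum_k \sum_l a k l = 0.
Proof.
move=> a0 aN; pose lt (k l : T) := (enum_rank k < enum_rank l)%N.
have split_lt k : \sum_l a k l = \sum_(l | lt k l) a k l + \sum_(l | lt l k) a k l.
  rewrite (bigID (lt k)) /=; congr (_ + _).
  rewrite (bigD1 k) /=; last by rewrite /lt ltnn.
  rewrite a0 add0r; apply: eq_bigl => l; rewrite /lt -leqNgt ltn_neqAle.
  by rewrite andbC (inj_eq (@ord_inj _)) (inj_eq enum_rank_inj).
rewrite (eq_bigr _ (fun k _ => split_lt k)) big_split /=.
rewrite [X in _ + X](exchange_big_dep xpredT) //= -big_split big1 // => k _.
rewrite -big_split big1 //= => l lt_kl; rewrite (aN k l) ?addNr //.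
by apply: contraTneq lt_kl => ->; rewrite /lt ltnn.
Qed.

Section Cohomology.
Variables (K : fieldType) (T : finType).
Implicit Types (s : T -> {set T} -> K) (c w : {set T} -> K) (X : pred {set T}).
Implicit Types (F A B G : {set T}) (k l : T) (q : nat).

(** The incidence sign of [k |: F] and [F] only has to make the two ways of
    removing two vertices anticommute.  Keeping it abstract allows a sign adapted
    to each construction: a restriction, a complement, a join. *)
Definition sign_on A s :=
  (forall k F, s k F * s k F = 1) /\
  (forall k l F, k \in A -> l \in A -> F \subset A -> k != l ->
     k \notin F -> l \notin F -> s k (l |: F) * s l F = - (s l (k |: F) * s k F)).

Definition coboundary s c F : K := \sum_(k in F) s k (F :\ k) * c (F :\ k).

(** Cohomology on faces of size [q], that is, in dimension [q - 1].  Cochains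
    are functions on all sets, considered only at the faces in [X]; for a
    simplicial complex this is the quotient by the functions vanishing on [X]. *)
Definition acyclic s X q :=
  forall c, (forall F, X F -> #|F| = q.+1 -> coboundary s c F = 0) ->
  exists w, forall F, X F -> #|F| = q -> c F = coboundary s w F.

Definition down_closed X := forall F G : {set T}, X F -> G \subset F -> X G.

Lemma sign_sub A B s : A \subset B -> sign_on B s -> sign_on A s.
Proof.
move=> sAB [s1 s2]; split=> // k l F kA lA FA; apply: s2.
- exact: (subsetP sAB).
- exact: (subsetP sAB).
- exact: subset_trans sAB.
Qed.

Lemma eq_acyclic s X Y q : X =1 Y -> acyclic s X q -> acyclic s Y q.
Proof.
move=> eXY aX c cc; have [|w hw] := aX c.
  by move=> F; rewrite eXY; apply: cc.
by exists w => F; rewrite -eXY; apply: hw.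
Qed.

Lemma coboundary_ext s c c' F :
  (forall k, k \in F -> c (F :\ k) = c' (F :\ k)) ->
  coboundary s c F = coboundary s c' F.
Proof. by move=> e; apply: eq_bigr => k /e ->. Qed.

Lemma coboundary_sub s c c' F :
  coboundary s (fun G => c G - c' G) F = coboundary s c F - coboundary s c' F.
Proof. by rewrite /coboundary -sumrB; apply: eq_bigr => k _; rewrite mulrBr. Qed.

Lemma coboundary_sum s (I : finType) (a : I -> K) (c : I -> {set T} -> K) F :
  coboundary s (fun G => \sum_i a i * c i G) F
  = \sum_i a i * coboundary s (c i) F.
Proof.
under eq_bigr => i _ do rewrite mulr_sumr.
rewrite exchange_big; apply: eq_bigr => k _; rewrite mulr_sumr.
by apply: eq_bigr => i _; rewrite mulrCA.
Qed.

Lemma coboundaryK s A c F : sign_on A s -> F \subset A ->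
  coboundary s (coboundary s c) F = 0.
Proof.
move=> [_ sa] FA; pose a k l :=
  if [&& k \in F, l \in F & k != l]
  then s k (F :\ k) * (s l (F :\ k :\ l) * c (F :\ k :\ l)) else 0.
rewrite -[RHS](@sum_antisym T K a) => [|k|k l nkl].
- rewrite /coboundary big_mkcond; apply: eq_bigr => k _.
  rewrite /a; case: (boolP (k \in F)) => kF; last by rewrite big1.
  rewrite mulr_sumr big_mkcond; apply: eq_bigr => l _.
  by rewrite in_setD1 eq_sym andbC.
- by rewrite /a eqxx !andbF.
rewrite /a [l == k]eq_sym nkl !andbT [in RHS]andbC.
case: ifP => [/andP[kF lF]|]; last by rewrite oppr0.
have sub (G : {set T}) : G \subset F -> G \subset A.
  by move=> h; apply: subset_trans h FA.
set G := F :\ k :\ l.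
have eG : F :\ l :\ k = G by rewrite /G setDDl setUC -setDDl.
have -> : F :\ k = l |: G by rewrite /G setD1K // !inE eq_sym nkl.
have -> : F :\ l = k |: G by rewrite -eG setD1K // !inE nkl.
have <- : G = (k |: G) :\ k by rewrite setU1K // !inE eqxx andbF.
rewrite !mulrA sa ?mulNr //; rewrite ?(subsetP FA) //.
- by rewrite sub // /G setDDl subsetDl.
- by rewrite !inE eqxx andbF.
- by rewrite !inE eqxx.
Qed.

(** The usual sign: the parity of the position of [k] in [k |: F]. *)
Definition std_sign k F : K :=
  (-1) ^+ #|[set l in F | (enum_rank l < enum_rank k)%N]|.

Lemma std_signP A : sign_on A std_sign.
Proof.
split=> [k F|k l F _ _ _ nkl kF lF]; first by rewrite -expr2 sqrr_sign.
pose below k F := [set m in F | (enum_rank m < enum_rank k)%N].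
have card_below m m' G : m \notin G ->
    #|below m' (m |: G)| = ((enum_rank m < enum_rank m') + #|below m' G|)%N.
  move=> mG; case: ltnP => h /=.
    have -> : below m' (m |: G) = m |: below m' G.
      apply/setP=> x; rewrite !inE andb_orl.
      by have [->|//] := eqVneq x m; rewrite h.
    by rewrite cardsU1 !inE (negPf mG).
  rewrite add0n; apply: eq_card => x; rewrite !inE.
  by have [->|//] := eqVneq x m; rewrite ltnNge h ?andbF.
rewrite /std_sign -/(below k (l |: F)) -/(below l (k |: F)) !card_below //.
rewrite -!exprD -/(below k F) -/(below l F).
have : (enum_rank l < enum_rank k)%N = ~~ (enum_rank k < enum_rank l)%N.
  rewrite -leqNgt ltn_neqAle.
  by rewrite (inj_eq (@ord_inj _)) (inj_eq enum_rank_inj) eq_sym nkl.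
move=> ->; set a := #|below k F|; set b := #|below l F|.
by case: (enum_rank k < _)%N; rewrite /= ?add0n ?add1n ?addSn exprS mulN1r ?opprK addnC.
Qed.
End Cohomology.

Section Gauge.
Variables (K : fieldType) (T : finType).
Implicit Types (s : T -> {set T} -> K) (c w : {set T} -> K) (X : pred {set T}).
Implicit Types (F A B G : {set T}) (k l : T) (q : nat).

(** The ratio of two sign rules is a multiplicative 1-cocycle of the cube of
    subsets of [A], and such a cocycle is a coboundary: [g] accumulates the ratio
    along the insertion of the elements one by one. *)
Lemma sign_gauge A s s' : sign_on A s -> sign_on A s' ->
  exists g : {set T} -> K, (forall F, g F * g F = 1) /\
    forall k F, k \in A -> F \subset A -> k \notin F ->
      g (k |: F) = s' k F * s k F * g F.
Proof.
move: {2}#|A| (leqnn #|A|) => m; elim: m A => [|m IHm] A cA sA s'A.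
  exists (fun=> 1); split=> [F|k F kA]; first by rewrite mulr1.
  by move: cA; rewrite leqn0 cards_eq0 => /eqP A0; rewrite A0 inE in kA.
case: (set_0Vmem A) => [A0|[x xA]].
  by apply: IHm => //; rewrite A0 cards0.
have sub : A :\ x \subset A by rewrite subsetDl.
have [|g0 [g1 g2]] := IHm (A :\ x) _ (sign_sub sub sA) (sign_sub sub s'A).
  by move: cA; rewrite (cardsD1 x A) xA.
exists (fun F => if x \in F then s' x (F :\ x) * s x (F :\ x) * g0 (F :\ x) else g0 F).
have [[s1 s2] [s1' s2']] := (sA, s'A); split=> [F|k F kA FA kF].
  case: ifP => // _; rewrite mulrACA g1 mulr1 mulrACA s1 s1'.
  by rewrite mulr1.
have [ekx|nkx] := eqVneq k x.
  by rewrite -ekx setU11 setU1K // (negPf kF).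
have kA0 : k \in A :\ x by rewrite !inE nkx.
rewrite in_setU1 eq_sym (negPf nkx) /=; case: ifP => xF; last first.
  by rewrite g2 // subsetD1 FA xF.
pose F0 := F :\ x; have xF0 : x \notin F0 by rewrite !inE eqxx.
have kF0 : k \notin F0 by rewrite !inE negb_and kF orbT.
have F0A : F0 \subset A by apply: subset_trans FA; rewrite subsetDl.
have eF : F = x |: F0 by rewrite setD1K.
have -> : (k |: F) :\ x = k |: F0.
  by rewrite eF setUCA setU1K // in_setU1 negb_or eq_sym nkx.
rewrite -/F0 g2 //; last by rewrite subsetD1 F0A.
have e1 := s2 k x F0 kA xA F0A nkx kF0 xF0.
have e2 := s2' k x F0 kA xA F0A nkx kF0 xF0.
rewrite -eF in e1 e2.
have : (s' k F * s' x F0) * (s k F * s x F0)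
     = (s' x (k |: F0) * s' k F0) * (s x (k |: F0) * s k F0).
  by rewrite e1 e2 mulrNN.
move=> e; transitivity ((s' x (k |: F0) * s' k F0) * (s x (k |: F0) * s k F0) * g0 F0).
  by ring.
by rewrite -e; ring.
Qed.

(** Rescaling cochains by the gauge identifies the two complexes. *)
Lemma acyclic_sign A s s' X q : sign_on A s -> sign_on A s' ->
  (forall F, X F -> F \subset A) -> acyclic s X q -> acyclic s' X q.
Proof.
move=> sA s'A XA acX; have [g [g1 g2]] := sign_gauge sA s'A.
have cobE c F : F \subset A ->
    coboundary s' c F = g F * coboundary s (fun G => g G * c G) F.
  move=> FA; rewrite /coboundary mulr_sumr; apply: eq_bigr => k kF.
  have kA := subsetP FA _ kF.
  have -> : g F = s' k (F :\ k) * s k (F :\ k) * g (F :\ k).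
    rewrite -g2 ?setD1K // ?setD11 //.
    by rewrite (subset_trans _ FA) // subsetDl.
  rewrite [RHS](_ : _ = s' k (F :\ k) * c (F :\ k) * (s k (F :\ k) * s k (F :\ k))
    * (g (F :\ k) * g (F :\ k))); last by ring.
  by rewrite g1 sA.1 !mulr1.
have gK F x y : g F * x = y -> x = g F * y by move=> <-; rewrite mulrA g1 mul1r.
move=> c cc; have [|w hw] := acX (fun F => g F * c F).
  move=> F XF cF; have := cc F XF cF; rewrite cobE ?XA // => /gK ->.
  by rewrite mulr0.
exists (fun F => g F * w F) => F XF cF; rewrite cobE ?XA //.
rewrite (gK _ _ _ (hw F XF cF)); congr (_ * _).
by apply: coboundary_ext => k _; rewrite mulrA g1 mul1r.
Qed.

Lemma coboundaryU1 s c k F : k \notin F ->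
  coboundary s c (k |: F) = s k F * c F
    + \sum_(l in F) s l (k |: F :\ l) * c (k |: F :\ l).
Proof.
move=> kF; rewrite /coboundary big_setU1 //= setU1K //; congr (_ + _).
apply: eq_bigr => l lF; suff -> : (k |: F) :\ l = k |: F :\ l by [].
rewrite setDUl; congr (_ :|: _); apply/setDidPl.
by rewrite disjoints1 inE; apply: contra kF => /eqP ->.
Qed.

Lemma sign_swap s k l F : sign_on setT s -> k != l -> k \notin F -> l \notin F ->
  s l (k |: F) = - (s k (l |: F) * s l F * s k F).
Proof.
move=> [s1 s2] nkl kF lF; rewrite s2 ?inE ?subsetT // mulNr opprK.
by rewrite -mulrA s1 mulr1.
Qed.

(** Removing the apex [k] from faces is a contracting homotopy. *)
Lemma acyclic_cone s X k q : sign_on setT s -> (forall F, X F -> X (k |: F)) ->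
  acyclic s X q.
Proof.
move=> sT coneX c cc; have [s1 _] := sT.
exists (fun G => if k \in G then 0 else s k G * c (k |: G)) => F XF cF.
have [kF|kF] := boolP (k \in F).
  rewrite /coboundary (bigD1 k) //= setD11 setD1K // mulrA s1 mul1r.
  rewrite big1 ?addr0 // => l /andP[lF nlk].
  by rewrite !inE eq_sym nlk kF mulr0.
have := cc (k |: F) (coneX F XF); rewrite cardsU1 kF cF => /(_ erefl).
rewrite coboundaryU1 // => e.
have : s k F * (s k F * c F + \sum_(l in F) s l (k |: F :\ l) * c (k |: F :\ l)) = 0.
  by rewrite e mulr0.
rewrite mulrDr mulrA s1 mul1r => /eqP; rewrite addr_eq0 => /eqP ->.
rewrite mulr_sumr -sumrN; apply: eq_bigr => l lF.
have nkl : k != l by apply: contraNneq kF => ->.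
have kFl : k \notin F :\ l by rewrite !inE negb_and kF orbT.
rewrite (negPf kFl) (sign_swap sT nkl) //; last by rewrite setD11.
rewrite setD1K // !mulNr mulrN opprK !mulrA s1 mul1r. by [].
Qed.

(** A cocycle bounds on the deletion of [x]; after subtraction of that
    boundary it lives on the faces containing [x], where it is a cocycle of the
    link of [x]. *)
Lemma acyclic_del_link s X x q : sign_on setT s -> down_closed X ->
  acyclic s (fun F => X F && (x \notin F)) q.+1 ->
  acyclic s (fun F => X (x |: F) && (x \notin F)) q ->
  acyclic s X q.+1.
Proof.
move=> sT dX acD acL c cc; have [s1 _] := sT.
have [|w1 hw1] := acD c; first by move=> F /andP[XF _]; apply: cc.
pose w1' F := if x \in F then 0 else w1 F.
pose c' F := c F - coboundary s w1' F.
have cc' F : X F -> #|F| = q.+2 -> coboundary s c' F = 0.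
  move=> XF cF; rewrite coboundary_sub cc // (coboundaryK _ sT) ?subsetT //.
  by rewrite subr0.
have c'0 F : X F -> x \notin F -> #|F| = q.+1 -> c' F = 0.
  move=> XF xF cF; rewrite /c' hw1 ?XF // /w1'; apply/eqP; rewrite subr_eq0.
  apply/eqP/coboundary_ext => k _.
  by rewrite !inE (negPf xF) andbF.
pose u F := s x F * c' (x |: F).
have [|v hv] := acL u.
  move=> F /andP[XF xF] cF.
  have := cc' _ XF; rewrite cardsU1 xF cF => /(_ erefl).
  rewrite coboundaryU1 // c'0 ?mulr0 ?add0r //; last first.
    by apply: dX XF _; rewrite subsetU1.
  move=> e; transitivity (- s x F * \sum_(l in F) s l (x |: F :\ l) * c' (x |: F :\ l)).
    rewrite /coboundary mulr_sumr; apply: eq_bigr => l lF.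
    have nxl : x != l by apply: contraNneq xF => ->.
    rewrite (sign_swap sT nxl) ?setD11 //; last by rewrite !inE (negPf xF) andbF.
    rewrite setD1K // /u !mulrA mulrNN; congr (_ * _).
    by rewrite !mulrA s1 mul1r.
  by rewrite e mulr0.
pose v' F := if x \in F then - (s x (F :\ x) * v (F :\ x)) else 0.
exists (fun F => w1' F + v' F) => F XF cF.
suff e : c' F = coboundary s v' F.
  move/eqP: e; rewrite subr_eq => /eqP ->; rewrite addrC /coboundary -big_split.
  by apply: eq_bigr => k _; rewrite mulrDr.
have [xF|xF] := boolP (x \in F); last first.
  rewrite c'0 // /coboundary big1 // => k _.
  by rewrite /v' !inE (negPf xF) andbF mulr0.
pose F0 := F :\ x; have xF0 : x \notin F0 by rewrite setD11.
have eF : F = x |: F0 by rewrite setD1K.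
have cF0 : #|F0| = q by move: cF; rewrite (cardsD1 x) xF => -[].
have := hv F0; rewrite -eF XF xF0 => /(_ erefl cF0); rewrite /u -eF => e.
have -> : c' F = s x F0 * coboundary s v F0 by rewrite -e mulrA s1 mul1r.
rewrite eF coboundaryU1 // /v' (negPf xF0) mulr0 add0r /coboundary mulr_sumr.
apply: eq_bigr => l lF.
have nxl : x != l by apply: contraNneq xF0 => ->.
have xFl : x \notin F0 :\ l by rewrite !inE eqxx andbF.
rewrite setU11 setU1K // (sign_swap sT nxl) ?setD11 // mulrNN setD1K //.
rewrite [RHS](_ : _ = s x F0 * s l (F0 :\ l) * v (F0 :\ l)
  * (s x (F0 :\ l) * s x (F0 :\ l))); last by ring.
by rewrite s1 mulr1 mulrA.
Qed.

End Gauge.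

Section Transport.
Variables (K : fieldType) (T T' : finType) (f : T -> T').
Hypothesis f_inj : injective f.

Lemma coboundary_imset (s' : T' -> {set T'} -> K) (c' : {set T'} -> K) (F : {set T}) :
  coboundary s' c' (f @: F)
  = coboundary (fun k G => s' (f k) (f @: G)) (fun G : {set T} => c' (f @: G)) F.
Proof.
rewrite /coboundary big_imset /=; last by move=> ? ? _ _ /f_inj.
apply: eq_bigr => k kF; suff -> : f @: F :\ f k = f @: (F :\ k) by [].
apply/setP=> y; apply/setD1P/imsetP => [[ny /imsetP[x xF ey]]|[x]].
  by exists x; rewrite // !inE xF andbT; apply: contraNneq ny => <-; rewrite ey.
rewrite !inE => /andP[nxk xF] ->; split; last exact: imset_f.
by rewrite (inj_eq f_inj).
Qed.

Lemma sign_on_imset (s' : T' -> {set T'} -> K) : sign_on setT s' ->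
  sign_on setT (fun k G => s' (f k) (f @: G)).
Proof.
move=> [s1 s2]; split=> [k F|k l F _ _ _ nkl kF lF]; first exact: s1.
by rewrite !imsetU1 s2 ?inE ?subsetT ?(inj_eq f_inj) ?(mem_imset _ _ f_inj).
Qed.

(** Pulling the sign rule back along [f] turns cochains of [X'] into cochains of
    [X]; the pulled back sign differs from [s] by a gauge. *)
Lemma acyclic_imset (s : T -> {set T} -> K) (s' : T' -> {set T'} -> K)
    (X : pred {set T}) (X' : pred {set T'}) q :
  sign_on setT s -> sign_on setT s' ->
  (forall F, X F = X' (f @: F)) -> (forall F', X' F' -> F' \subset f @: setT) ->
  acyclic s X q <-> acyclic s' X' q.
Proof.
move=> sT s'T eX X'f; have s0T := sign_on_imset s'T.
pose s0 (k : T) (G : {set T}) := s' (f k) (f @: G); rewrite -/s0 in s0T.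
have preK (F : {set T}) : f @^-1: (f @: F) = F.
  by apply/setP=> x; rewrite inE mem_imset.
have imK F' : X' F' -> f @: (f @^-1: F') = F'.
  move=> /X'f/subsetP F'f; apply/setP=> y; apply/imsetP/idP.
    by case=> x; rewrite inE => xF' ->.
  by move=> yF'; case/imsetP: (F'f y yF') => x _ ey; exists x; rewrite // inE -ey.
have XT F : X F -> F \subset setT by rewrite subsetT.
split=> [acX|acX'].
  move=> c' cc'; have acX0 := acyclic_sign sT s0T XT acX.
  have [|w hw] := acX0 (fun G : {set T} => c' (f @: G)).
    move=> F XF cF; rewrite -coboundary_imset cc' -?eX //.
    by rewrite card_imset.
  exists (fun G : {set T'} => w (f @^-1: G)) => F' XF' cF'; rewrite -(imK F' XF').
  rewrite coboundary_imset hw ?eX ?imK //; last by rewrite -(card_imset _ f_inj) imK.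
  by apply: coboundary_ext => k _; rewrite preK.
apply: (acyclic_sign s0T sT XT) => c cc; have [|w hw] := acX' (fun G : {set T'} => c (f @^-1: G)).
  move=> F' XF' cF'; rewrite -(imK F' XF') coboundary_imset.
  rewrite -(cc (f @^-1: F')) ?eX ?imK //; last by rewrite -(card_imset _ f_inj) imK.
  by apply: coboundary_ext => k _; rewrite preK.
exists (fun G : {set T} => w (f @: G)) => F XF cF.
rewrite -[in LHS](preK F) hw -?eX ?card_imset //.
by rewrite coboundary_imset.
Qed.
End Transport.

(** * Splitting a complex over a field *)

(** A linear map over a field has a generalized inverse.  It is the source of the
    two consequences of linear algebra used below: a linear choice of primitives
    and a functional that detects a nonzero class. *)
Lemma pseudoinverse (K : fieldType) (I : finType) (D : I -> I -> K) :
  exists P : I -> I -> K, forall i l,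
    \sum_j \sum_k D i j * P j k * D k l = D i l.
Proof.
pose A : 'M[K]_#|I| := \matrix_(i, j) D (enum_val i) (enum_val j).
have AE i j : D i j = A (enum_rank i) (enum_rank j) by rewrite mxE !enum_rankK.
have e := mulmxKpV (submx_refl A); set Q := pinvmx A in e.
exists (fun j k => Q (enum_rank j) (enum_rank k)) => i l.
have big_rank (f : 'I_#|I| -> K) : \sum_j f (enum_rank j) = \sum_j f j.
  by rewrite [RHS](reindex enum_rank) //; apply: onW_bij; apply: enum_rank_bij.
under eq_bigr => j _ do under eq_bigr => k _ do rewrite !AE.
rewrite (big_rank (fun j => \sum_k A (enum_rank i) j * Q j (enum_rank k)
  * A (enum_rank k) (enum_rank l))).
rewrite AE -[in RHS]e mxE.
under [RHS]eq_bigr => k _ do rewrite mxE mulr_suml.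
rewrite [RHS]exchange_big; apply: eq_bigr => j _ /=.
by rewrite (big_rank (fun k => A (enum_rank i) j * Q j k * A k (enum_rank l))).
Qed.

Section Act.
Variables (K : fieldType) (I : finType).
Implicit Types (c : I -> K) (M N : I -> I -> K).

Definition act M c (j : I) : K := \sum_i c i * M i j.
Definition mx_comp M N (i j : I) : K := \sum_k M i k * N k j.

Lemma act_comp M N c j : act N (act M c) j = act (mx_comp M N) c j.
Proof.
rewrite /act; under eq_bigr => k _ do rewrite mulr_suml.
rewrite exchange_big; apply: eq_bigr => i _; rewrite mulr_sumr.
by apply: eq_bigr => k _; rewrite mulrA.
Qed.

Lemma act_subr M c c' j : act M (fun i => c i - c' i) j = act M c j - act M c' j.
Proof. by rewrite /act -sumrB; apply: eq_bigr => i _; rewrite mulrBl. Qed.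

Lemma act_subl M N c j : act (fun i k => M i k - N i k) c j = act M c j - act N c j.
Proof. by rewrite /act -sumrB; apply: eq_bigr => i _; rewrite mulrBr. Qed.

Lemma eq_act M c c' j : (forall i, M i j != 0 -> c i = c' i) -> act M c j = act M c' j.
Proof.
move=> e; apply: eq_bigr => i _; have [->|/e->//] := eqVneq (M i j) 0.
by rewrite !mulr0.
Qed.
End Act.

Section Linear.
Variables (K : fieldType) (T : finType) (s : T -> {set T} -> K).
Hypothesis sT : sign_on setT s.
Variable X : pred {set T}.
Hypothesis dX : down_closed X.
Implicit Types (c w : {set T} -> K) (F G : {set T}) (k l : T) (q : nat).

(** The matrix of the coboundary of [X]: [c] is sent to the function
    [\sum_G c G * incidence G F] of [F]. *)
Definition incidence G F : K := \sum_(k in F) (F :\ k == G)%:R * s k G * (X F)%:R.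

Lemma coboundary_incidence c F : X F -> coboundary s c F = \sum_G c G * incidence G F.
Proof.
move=> XF; under [RHS]eq_bigr => G _ do rewrite /incidence mulr_sumr.
rewrite exchange_big; apply: eq_bigr => k kF /=.
rewrite (bigD1 (F :\ k)) //= eqxx XF mul1r mulr1 mulrC big1 ?addr0 // => G nG.
by rewrite eq_sym (negPf nG) !mul0r mulr0.
Qed.

Lemma incidence_grade G F : incidence G F != 0 -> [/\ X F, X G & #|F| = #|G|.+1].
Proof.
move=> nz; have [XF|nXF] := boolP (X F); last first.
  by case/eqP: nz; rewrite /incidence big1 // => k _; rewrite (negPf nXF) mulr0.
have [k /andP[kF /eqP <-]|h] := pickP [pred k | (k \in F) && (F :\ k == G)].
  by split; rewrite ?(dX XF) ?subsetDl // (cardsD1 k F) kF.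
case/eqP: nz; rewrite /incidence big1 // => k kF.
by have := h k; rewrite /= kF /= => ->; rewrite !mul0r.
Qed.

(** The entries of a pseudoinverse that do not lower the size by one can be
    discarded, since the coboundary raises the size by exactly one. *)
Lemma graded_pseudoinverse : exists P : {set T} -> {set T} -> K,
  (forall F G, P F G != 0 -> X F /\ #|F| = #|G|.+1) /\
  forall c F, act incidence (act P (act incidence c)) F = act incidence c F.
Proof.
have [P hP] := pseudoinverse incidence.
exists (fun F G => if X F && (#|F| == #|G|.+1) then P F G else 0).
split=> [F G|c F]; first by case: ifP => [/andP[-> /eqP ->]|_]; rewrite ?eqxx.
rewrite !act_comp; apply: eq_bigr => G _; congr (_ * _).
rewrite /mx_comp; under eq_bigr => G1 _ do
  (rewrite mulr_sumr; under eq_bigr => G2 _ do rewrite mulrA).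
have [gr|ngr] := boolP (#|F| == #|G|.+1).
  rewrite -[RHS]hP; apply: eq_bigr => G1 _; apply: eq_bigr => G2 _.
  have [->|/incidence_grade[XG1 _ e1]] := eqVneq (incidence G G1) 0; first by rewrite !mul0r.
  have [->|/incidence_grade[_ _ e3]] := eqVneq (incidence G2 F) 0; first by rewrite !mulr0.
  by rewrite XG1 /= e1 -e3 (eqP gr) eqxx.
transitivity (0 : K); last first.
  by apply/esym/eqP; apply: contraNT ngr => /incidence_grade[_ _ ->].
rewrite big1 // => G1 _; rewrite big1 // => G2 _.
have [->|/incidence_grade[_ _ e1]] := eqVneq (incidence G G1) 0; first by rewrite !mul0r.
case: ifP => [/andP[_ /eqP e2]|_]; last by rewrite mulr0 mul0r.
have [->|/incidence_grade[_ _ e3]] := eqVneq (incidence G2 F) 0; first by rewrite mulr0.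
by case/eqP: ngr; rewrite e3 -e2 e1.
Qed.

(** If the cohomology vanishes above size [p], there is a homotopy [M] with
    [d M + M d = 1] above size [p].  With [P] a pseudoinverse of [d], cocycles
    satisfy [z = d (P z)], and [M = P (1 - P d)] works because [c - P (d c)] is a
    cocycle.  The point is that [M] is linear, hence applies with coefficients
    in a second complex. *)
Lemma acyclic_contraction p : (forall q, (p < q)%N -> acyclic s X q) ->
  exists M : {set T} -> {set T} -> K,
    (forall F G, M F G != 0 -> X F /\ #|F| = #|G|.+1) /\
    forall c F, X F -> (p < #|F|)%N ->
      c F = coboundary s (act M c) F + act M (coboundary s c) F.
Proof.
move=> acX; have [P [grP dhd]] := graded_pseudoinverse.
have dE c F : X F -> act incidence c F = coboundary s c F by move/coboundary_incidence.
(* a cocycle z above size p is d w for some w, and d (P (d w)) = d w *)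
have sec z F : (forall G, X G -> #|G| = #|F|.+1 -> coboundary s z G = 0) ->
    X F -> (p < #|F|)%N -> act incidence (act P z) F = z F.
  move=> cz XF pF; have [w hw] := acX _ pF z cz.
  have -> : z F = act incidence w F by rewrite dE // hw.
  rewrite -[RHS]dhd.
  apply: eq_act => G /incidence_grade[_ XG cF]; apply: eq_act => F' /grP[XF' cF'].
  by rewrite dE // hw // cF' cF.
have mcomp_nz (A B : {set T} -> {set T} -> K) F G : mx_comp A B F G != 0 ->
    exists H, A F H != 0 /\ B H G != 0.
  move=> nz; case: (pickP [pred H | (A F H != 0) && (B H G != 0)]) => [H|h].
    by case/andP; exists H.
  case/eqP: nz; apply: big1 => H _; apply/eqP; rewrite mulf_eq0.
  by have := h H; rewrite /=; case: eqP => //= _ /negbFE.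
pose N := mx_comp (mx_comp incidence P) P.
exists (fun F G => P F G - N F G); split=> [F G|c F XF pF].
  have [P0|/grP[]//] := eqVneq (P F G) 0; rewrite P0 sub0r oppr_eq0.
  case/mcomp_nz => H [/mcomp_nz[H' [/incidence_grade[_ XF e1] /grP[_ e2]]] /grP[_ <-]].
  by split=> //; apply: succn_inj; rewrite -e2 e1.
have actM z G : act (fun F G => P F G - N F G) z G
    = act P (fun F => z F - act P (act incidence z) F) G.
  rewrite act_subl act_subr; congr (_ - _).
  rewrite -(act_comp (mx_comp incidence P) P z G); apply: eq_act => H _.
  by rewrite -(act_comp incidence P z H).
rewrite -(dE _ _ XF).
have -> : act incidence (act (fun F0 G => P F0 G - N F0 G) c) F
    = act incidence (act P (fun F => c F - act P (act incidence c) F)) F.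
  by apply: eq_act => G _; apply: actM.
rewrite sec //; last first.
  by move=> G XG _; rewrite -dE // act_subr dhd subrr.
rewrite actM -[LHS](subrK (act P (act incidence c) F)); congr (_ + _).
apply: eq_act => G /grP[XG _]; rewrite dE //.
rewrite (_ : act P _ G = 0) ?subr0 // /act big1 // => H _.
have [->|/grP[XH _]] := eqVneq (P H G) 0; first by rewrite mulr0.
by rewrite -/(act incidence _ H) dE // (coboundaryK _ sT) ?subsetT ?mul0r.
Qed.
End Linear.

Section Dual.
Variables (K : fieldType) (T : finType) (s : T -> {set T} -> K).
Implicit Types (c w : {set T} -> K) (F G : {set T}) (k l : T) (q : nat).

(** A cocycle outside the image of the coboundary is separated from it by a
    functional [phi], taken from a column of [1 - P d]. *)
Lemma not_acyclic_dual (X : pred {set T}) q : ~ acyclic s X q ->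
  exists c (phi : {set T} -> K),
    [/\ forall F, X F -> #|F| = q.+1 -> coboundary s c F = 0,
        forall F, phi F != 0 -> X F /\ #|F| = q,
        \sum_F phi F * c F != 0
      & forall w, \sum_F phi F * coboundary s w F = 0].
Proof.
move=> nac; pose X' : pred {set T} := fun F => X F && (#|F| == q).
have [c [cc nw]] : exists c, (forall F, X F -> #|F| = q.+1 -> coboundary s c F = 0) /\
    ~ exists w, forall F, X F -> #|F| = q -> c F = coboundary s w F.
  apply: Classical_Prop.NNPP => h; apply: nac => c cc.
  by apply: Classical_Prop.NNPP => nw; apply: h; exists c.
pose D := incidence s X'; have [P hP] := pseudoinverse D.
pose c0 F := if X' F then c F else 0.
have D0 G F : ~~ X' F -> D G F = 0.
  by move=> nX; rewrite /D /incidence big1 // => k _; rewrite (negPf nX) mulr0.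
have [F0 neF0] : exists F0, act D (act P c0) F0 != c0 F0.
  apply: Classical_Prop.NNPP => h; apply: nw; exists (act P c0) => F XF cF.
  have X'F : X' F by rewrite /X' XF cF eqxx.
  rewrite (coboundary_incidence _ _ X'F) -/(act _ _ _) -/D.
  have -> : act D (act P c0) F = c0 F.
    by apply/eqP; apply: contraT => ne; case: h; exists F.
  by rewrite /c0 X'F.
pose phi F := if X' F then (F == F0)%:R - mx_comp P D F F0 else 0.
exists c, phi; split=> // [F||w].
- by rewrite /phi; case: ifP; rewrite ?eqxx // => /andP[-> /eqP].
- have -> : \sum_F phi F * c F = c0 F0 - act D (act P c0) F0.
    rewrite act_comp -[c0 F0](_ : \sum_F c0 F * (F == F0)%:R = _); last first.
      by rewrite (bigD1 F0) //= eqxx mulr1 big1 ?addr0 // => F /negPf ->; rewrite mulr0.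
    rewrite /act -sumrB; apply: eq_bigr => F _; rewrite /phi /c0.
    by case: ifP => _; [rewrite mulrC mulrBr | rewrite !mul0r subr0].
  by rewrite subr_eq0 eq_sym.
transitivity (\sum_G w G * (D G F0 - \sum_j \sum_k D G j * P j k * D k F0)).
  transitivity (\sum_F \sum_G w G * (D G F * ((F == F0)%:R - mx_comp P D F F0))).
    apply: eq_bigr => F _; have [XF|nXF] := boolP (X' F); last first.
      rewrite /phi (negPf nXF) mul0r big1 // => G _.
      by rewrite D0 // mul0r mulr0.
    rewrite /phi XF (coboundary_incidence _ _ XF) mulrC mulr_suml.
    by apply: eq_bigr => G _; rewrite mulrA.
  rewrite exchange_big; apply: eq_bigr => G _ /=; rewrite -mulr_sumr; congr (_ * _).
  rewrite (eq_bigr (fun F => D G F * (F == F0)%:R - D G F * mx_comp P D F F0)) => [|F _]; last first.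
    exact: mulrBr.
  rewrite sumrB (bigD1 F0) //= eqxx mulr1 big1 ?addr0 => [|F /negPf ->]; last first.
    by rewrite mulr0.
  congr (_ - _); apply: eq_bigr => F _; rewrite /mx_comp mulr_sumr.
  by apply: eq_bigr => H _; rewrite mulrA.
by rewrite big1 // => G _; rewrite hP subrr mulr0.
Qed.
End Dual.

(** * The Künneth formula for joins *)

Section Join.
Variables (K : fieldType) (T : finType) (s : T -> {set T} -> K).
Hypothesis sT : sign_on setT s.
Implicit Types (c w : {set T} -> K) (F G : {set T}) (k l : T) (q : nat).
Implicit Types (phi psi : {set T} -> {set T} -> K).

(** The sign for which the cochain complex of a join of complexes on [A] and on
    the complement of [A] is the tensor product of their cochain complexes. *)
Definition join_sign (A : {set T}) k F : K :=
  if k \in A then s k (F :&: A) else (-1) ^+ #|F :&: A| * s k (F :\: A).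

Lemma join_signP (A : {set T}) : sign_on setT (join_sign A).
Proof.
have [s1 s2] := sT; split=> [k F|k l F _ _ _ nkl kF lF]; rewrite /join_sign.
  by case: ifP => _; rewrite // mulrACA -expr2 sqrr_sign s1 mulr1.
have UI m : m \in A -> (m |: F) :&: A = m |: (F :&: A).
  by move=> mA; rewrite setIUl; congr (_ :|: _); apply/setIidPl; rewrite sub1set.
have UI' m : m \notin A -> (m |: F) :&: A = F :&: A.
  move=> mA; rewrite setIUl -[RHS]set0U; congr (_ :|: _).
  by apply/eqP; rewrite setI_eq0 disjoints1.
have UD m : m \notin A -> (m |: F) :\: A = m |: (F :\: A).
  by move=> mA; rewrite setDUl; congr (_ :|: _); apply/setDidPl; rewrite disjoints1.
have UD' m : m \in A -> (m |: F) :\: A = F :\: A.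
  move=> mA; rewrite setDUl -[RHS]set0U; congr (_ :|: _).
  by apply/eqP; rewrite setD_eq0 sub1set.
have nI m : m \notin F -> m \notin F :&: A by move=> h; rewrite inE (negPf h).
have nD m : m \notin F -> m \notin F :\: A by move=> h; rewrite inE (negPf h) andbF.
case: ifP => kA; case: ifP => lA.
- by rewrite !UI // s2 ?inE ?subsetT ?(negPf kF) ?(negPf lF).
- rewrite (UI' l) ?lA // UI // (UD' k) // cardsU1 nI // exprS.
  by rewrite mulN1r !mulNr opprK mulrC.
- rewrite (UI' k) ?kA // UI // (UD' l) // cardsU1 nI // exprS.
  by rewrite mulN1r !mulNr mulrC.
rewrite !UI' ?kA ?lA // !UD ?kA ?lA //.
rewrite mulrACA [in RHS]mulrACA s2 ?mulrN ?inE ?subsetT //.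
- by rewrite (negPf kF) andbF.
- by rewrite (negPf lF) andbF.
Qed.

(** The differential of a tensor product of cochain complexes. *)
Definition bicoboundary phi F1 F2 : K :=
  coboundary s (phi^~ F2) F1 + (-1) ^+ #|F1| * coboundary s (phi F1) F2.

Lemma coboundary_join (A : {set T}) c F1 F2 : F1 \subset A -> F2 \subset ~: A ->
  coboundary (join_sign A) c (F1 :|: F2) = bicoboundary (fun G1 G2 => c (G1 :|: G2)) F1 F2.
Proof.
move=> F1A F2A; have F1nA k : k \in F1 -> k \in A by apply: subsetP.
have F2nA k : k \in F2 -> k \notin A by move/(subsetP F2A); rewrite inE.
have dF : [disjoint F1 & F2].
  apply/pred0P => k /=; apply/andP => -[/F1nA kA /F2nA].
  by rewrite kA.
rewrite /bicoboundary /coboundary (eq_bigl [predU F1 & F2]) => [|k]; last by rewrite !inE.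
rewrite bigU //= mulr_sumr.
congr (_ + _); apply: eq_bigr => k kF.
  have -> : (F1 :|: F2) :\ k = F1 :\ k :|: F2.
    rewrite setDUl; congr (_ :|: _); apply/setDidPl; rewrite disjoint_sym disjoints1.
    by apply: contraTN (F1nA k kF) => /F2nA.
  rewrite /join_sign F1nA // setIUl (_ : F2 :&: A = set0) ?setU0; last first.
    by apply/eqP; rewrite setI_eq0 disjoints_subset.
  suff -> : (F1 :\ k) :&: A = F1 :\ k by [].
  by apply/setIidPl; rewrite (subset_trans _ F1A) // subsetDl.
have -> : (F1 :|: F2) :\ k = F1 :|: F2 :\ k.
  rewrite setDUl; congr (_ :|: _); apply/setDidPl; rewrite disjoint_sym disjoints1.
  by apply: contraTN kF => /F1nA kA; apply/negP => /F2nA; rewrite kA.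
rewrite /join_sign (negPf (F2nA k kF)) mulrA.
have -> : (F1 :|: F2 :\ k) :&: A = F1.
  rewrite setIUl (setIidPl F1A); apply/setUidPl; apply/subsetP => x.
  by rewrite !inE => /andP[/andP[_ /F2nA xA]]; rewrite (negPf xA).
congr (_ * s k _ * _).
rewrite setDUl (_ : F1 :\: A = set0) ?set0U; last by apply/eqP; rewrite setD_eq0.
apply/setDidPl; rewrite disjoints_subset.
by rewrite (subset_trans _ F2A) // subsetDl.
Qed.

Section Bicomplex.
Variables X Y : pred {set T}.

(** Acyclicity of the total complex of the tensor product; a cochain of total
    degree [q] is a function of two faces whose sizes add up to [q]. *)
Definition biacyclic q := forall phi,
  (forall F1 F2, X F1 -> Y F2 -> (#|F1| + #|F2| = q.+1)%N -> bicoboundary phi F1 F2 = 0) ->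
  exists psi, forall F1 F2, X F1 -> Y F2 -> (#|F1| + #|F2| = q)%N ->
    phi F1 F2 = bicoboundary psi F1 F2.

Lemma acyclic_joinE (A : {set T}) q :
  (forall F, X F -> F \subset A) -> (forall F, Y F -> F \subset ~: A) ->
  acyclic (join_sign A) (fun F => X (F :&: A) && Y (F :\: A)) q <-> biacyclic q.
Proof.
move=> XA YA.
have UI F1 F2 : F1 \subset A -> F2 \subset ~: A -> (F1 :|: F2) :&: A = F1.
  move=> F1A F2A; rewrite setIUl (setIidPl F1A); apply/setUidPl.
  apply/subsetP => x; rewrite !inE => /andP[/(subsetP F2A)].
  by rewrite inE => /negPf ->.
have UD F1 F2 : F1 \subset A -> F2 \subset ~: A -> (F1 :|: F2) :\: A = F2.
  move=> F1A F2A; rewrite setDUl (_ : F1 :\: A = set0) ?set0U.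
    by rewrite setDE; apply/setIidPl.
  by apply/eqP; rewrite setD_eq0.
have cU F1 F2 : X F1 -> Y F2 -> #|F1 :|: F2| = (#|F1| + #|F2|)%N.
  by move=> /XA XF /YA YF; rewrite -(cardsID A) UI ?UD.
have sub (w : {set T} -> {set T} -> K) F1 F2 : X F1 -> Y F2 ->
    coboundary (join_sign A) (fun F => w (F :&: A) (F :\: A)) (F1 :|: F2)
    = bicoboundary w F1 F2.
  move=> /XA XF /YA YF; rewrite coboundary_join //.
  rewrite /bicoboundary; congr (_ + _ * _); apply: coboundary_ext => k kF /=.
    by rewrite UI ?UD // (subset_trans _ XF) // subsetDl.
  by rewrite UI ?UD // (subset_trans _ YF) // subsetDl.
split=> [ac phi cphi|bi c cc].
  have [|w hw] := ac (fun F => phi (F :&: A) (F :\: A)).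
    move=> F /andP[XF YF] cF; rewrite -(setID F A) sub // cphi //.
    by rewrite cardsID.
  exists (fun F1 F2 => w (F1 :|: F2)) => F1 F2 XF YF cF.
  have [F1A F2A] := (XA _ XF, YA _ YF).
  rewrite -(coboundary_join _ F1A F2A) // -hw ?UI ?UD ?XF ?YF //.
  by rewrite cU.
have [|psi hpsi] := bi (fun F1 F2 => c (F1 :|: F2)).
  move=> F1 F2 XF YF cF; have [F1A F2A] := (XA _ XF, YA _ YF).
  by rewrite -(coboundary_join _ F1A F2A) // cc ?UI ?UD ?XF // cU.
exists (fun F => psi (F :&: A) (F :\: A)) => F /andP[XF YF] cF.
rewrite -{2}(setID F A) sub // -hpsi ?setID //.
by rewrite cardsID.
Qed.

Lemma coboundary_act (I : finType) (M : I -> I -> K) (phi : I -> {set T} -> K) j F :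
  coboundary s (fun G => act M (phi^~ G) j) F
  = act M (fun i => coboundary s (phi i) F) j.
Proof.
rewrite /coboundary /act; under eq_bigr => k _ do rewrite mulr_sumr.
rewrite exchange_big; apply: eq_bigr => i _; rewrite mulr_suml.
by apply: eq_bigr => k _; rewrite mulrA.
Qed.

Lemma coboundary_scale a c F : coboundary s (fun G => a * c G) F = a * coboundary s c F.
Proof. by rewrite mulr_sumr; apply: eq_bigr => k _; rewrite mulrCA. Qed.

Lemma coboundary_parity c F :
  coboundary s (fun G => (-1) ^+ #|G| * c G) F = - ((-1) ^+ #|F| * coboundary s c F).
Proof.
rewrite /coboundary mulr_sumr -sumrN; apply: eq_bigr => k kF.
by rewrite [#|F|](cardsD1 k) kF exprS mulN1r mulNr opprK mulrCA.
Qed.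

Lemma bicoboundary_sub phi psi F1 F2 :
  bicoboundary (fun G1 G2 => phi G1 G2 - psi G1 G2) F1 F2 = bicoboundary phi F1 F2 - bicoboundary psi F1 F2.
Proof. by rewrite /bicoboundary !coboundary_sub mulrBr; ring. Qed.

Lemma bicoboundaryK phi F1 F2 : bicoboundary (bicoboundary phi) F1 F2 = 0.
Proof.
have coboundaryD c c' F :
    coboundary s (fun G => c G + c' G) F = coboundary s c F + coboundary s c' F.
  by rewrite /coboundary -big_split; apply: eq_bigr => k _; rewrite mulrDr.
rewrite {1}/bicoboundary; rewrite (_ : bicoboundary phi^~ F2 = fun G1 => coboundary s (phi^~ F2) G1
  + (-1) ^+ #|G1| * coboundary s (phi G1) F2) //.
rewrite (_ : bicoboundary phi F1 = fun G2 => coboundary s (phi^~ G2) F1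
  + (-1) ^+ #|F1| * coboundary s (phi F1) G2) // !coboundaryD.
rewrite coboundary_scale coboundary_parity !(coboundaryK _ sT) ?subsetT //.
rewrite mulr0 addr0 add0r; suff -> : coboundary s (fun G => coboundary s (phi G) F2) F1
    = coboundary s (fun G => coboundary s (phi^~ G) F1) F2 by rewrite addNr.
rewrite /coboundary; under eq_bigr => k _ do rewrite mulr_sumr.
under [RHS]eq_bigr => k _ do rewrite mulr_sumr.
rewrite exchange_big; apply: eq_bigr => k _; apply: eq_bigr => l _.
by rewrite mulrCA.
Qed.

(** Let [M1], [M2] be contractions of the two factors above [p1], [p2].
    Subtracting from a cocycle the boundary of its image by [M1] leaves a cocycle
    [g] supported on first sizes at most [p1], hence on second sizes above [p2],
    and the contraction [M2] makes [g] a boundary. *)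
Lemma biacyclic_upper p1 p2 q : down_closed X -> down_closed Y ->
  (forall q, (p1 < q)%N -> acyclic s X q) ->
  (forall q, (p2 < q)%N -> acyclic s Y q) ->
  (p1 + p2 < q)%N -> biacyclic q.
Proof.
move=> dX dY acX acY ltq phi cphi.
have [M1 [grM1 conM1]] := acyclic_contraction sT dX acX.
have [M2 [grM2 conM2]] := acyclic_contraction sT dY acY.
pose h1 F1 F2 := act M1 (phi^~ F2) F1.
pose g F1 F2 := phi F1 F2 - bicoboundary h1 F1 F2.
have bg F1 F2 : X F1 -> Y F2 -> (#|F1| + #|F2| = q.+1)%N -> bicoboundary g F1 F2 = 0.
  by move=> XF YF cF; rewrite bicoboundary_sub cphi // bicoboundaryK subr0.
have g0 F1 F2 : X F1 -> Y F2 -> (#|F1| + #|F2| = q)%N -> (p1 < #|F1|)%N -> g F1 F2 = 0.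
  move=> XF YF cF pF; apply/eqP; rewrite /g subr_eq0 (conM1 (phi^~ F2) F1) // /bicoboundary.
  apply/eqP; congr (_ + _); rewrite [coboundary s (h1 F1) F2](coboundary_act M1 phi).
  rewrite /act mulr_sumr; apply: eq_bigr => i _.
  have [->|/grM1[Xi ci]] := eqVneq (M1 i F1) 0; first by rewrite !mulr0.
  have := cphi i F2 Xi YF; rewrite ci addSn cF => /(_ erefl).
  rewrite /bicoboundary ci exprS mulN1r mulNr => /eqP; rewrite subr_eq0 => /eqP ->.
  by rewrite mulrA.
(* the sign makes M2 commute with the differential of the first factor *)
pose h2 F1 F2 := (-1) ^+ #|F1| * act M2 (g F1) F2.
suff gE F1 F2 : X F1 -> Y F2 -> (#|F1| + #|F2| = q)%N -> g F1 F2 = bicoboundary h2 F1 F2.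
  have oppE F1 F2 : bicoboundary (fun G1 G2 => 0 - h2 G1 G2) F1 F2 = - bicoboundary h2 F1 F2.
    rewrite bicoboundary_sub (_ : bicoboundary _ F1 F2 = 0) ?sub0r //.
    by rewrite /bicoboundary /coboundary !big1 ?mulr0 ?addr0 // => *; rewrite mulr0.
  exists (fun F1 F2 => h1 F1 F2 - (0 - h2 F1 F2)) => F1 F2 XF YF cF.
  have := gE F1 F2 XF YF cF; rewrite {1}/g => /eqP; rewrite subr_eq => /eqP ->.
  by rewrite bicoboundary_sub oppE opprK addrC.
move=> XF YF cF.
have -> : bicoboundary h2 F1 F2 = coboundary s (act M2 (g F1)) F2 + act M2 (coboundary s (g F1)) F2.
  rewrite /bicoboundary /h2 coboundary_scale mulrA -expr2 sqrr_sign mul1r addrC.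
  rewrite coboundary_parity coboundary_act; congr (_ + _).
  rewrite /act mulr_sumr -sumrN; apply: eq_bigr => i _.
  have [->|/grM2[Yi ci]] := eqVneq (M2 i F2) 0; first by rewrite !mulr0 oppr0.
  have := bg F1 i XF Yi; rewrite ci addnS cF => /(_ erefl).
  rewrite /bicoboundary => /eqP; rewrite addr_eq0 => /eqP ->.
  by rewrite mulNr mulrN opprK !mulrA -expr2 sqrr_sign mul1r.
have [pF|pF] := ltnP p2 #|F2|; first exact: conM2.
have p1F : (p1 < #|F1|)%N by lia.
have gF G : Y G -> #|G| = #|F2| -> g F1 G = 0 by move=> YG cG; apply: g0; rewrite ?cG.
rewrite gF // {1}/coboundary big1 ?add0r => [|k kF]; last first.
  rewrite /act big1 ?mulr0 // => i _.
  have [->|/grM2[Yi ci]] := eqVneq (M2 i (F2 :\ k)) 0; first by rewrite mulr0.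
  by rewrite gF ?mul0r // ci (cardsD1 k F2) kF.
rewrite /act big1 // => i _.
have [->|/grM2[Yi ci]] := eqVneq (M2 i F2) 0; first by rewrite mulr0.
rewrite /coboundary big1 ?mul0r // => k kF; rewrite gF ?mulr0 //.
  by apply: dY Yi _; rewrite subsetDl.
by move: ci; rewrite (cardsD1 k i) kF add1n => -[].
Qed.

(** Let [c1] be a nonzero class of the first factor and [phi] a functional that
    detects it.  If the product of [c1] with a cocycle [c2] bounds, then
    contracting with [phi] shows that [c2] bounds. *)
Lemma biacyclic_lower q1 q2 : ~ acyclic s X q1 -> biacyclic (q1 + q2) -> acyclic s Y q2.
Proof.
move=> nX bi c2 cc2; have [c1 [phi [cc1 sphi phic1 phid]]] := not_acyclic_dual nX.
pose cut q (c : {set T} -> K) F := if #|F| == q then c F else 0.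
have cut_cocycle (Z : pred {set T}) c q F : (forall F, Z F -> #|F| = q.+1 -> coboundary s c F = 0) ->
    Z F -> coboundary s (cut q c) F = 0.
  move=> cc ZF; have [cF|ncF] := eqVneq #|F| q.+1.
    rewrite -[RHS](cc F) //; apply: coboundary_ext => k kF; rewrite /cut.
    by move: cF; rewrite (cardsD1 k) kF add1n => -[->]; rewrite eqxx.
  rewrite /coboundary big1 // => k kF; rewrite /cut; case: eqP => [e|_]; last by rewrite mulr0.
  by case/eqP: ncF; rewrite -e (cardsD1 k F) kF.
have [|psi hpsi] := bi (fun F1 F2 => cut q1 c1 F1 * cut q2 c2 F2).
  move=> F1 F2 XF YF _; rewrite /bicoboundary coboundary_scale (cut_cocycle Y) // mulr0 mulr0 addr0.
  rewrite -[RHS](mulr0 (cut q2 c2 F2)) -(cut_cocycle X c1 q1 F1) // -coboundary_scale.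
  by apply: coboundary_ext => k _; rewrite mulrC.
exists (fun F2 => (-1) ^+ q1 / (\sum_F phi F * c1 F) * \sum_F1 phi F1 * psi F1 F2) => F2 YF cF.
rewrite coboundary_scale coboundary_sum.
have : \sum_F phi F * c1 F * c2 F2 = (-1) ^+ q1 * \sum_F1 phi F1 * coboundary s (psi F1) F2.
  transitivity (\sum_F1 phi F1 * bicoboundary psi F1 F2).
    apply: eq_bigr => F1 _; have [->|/sphi[XF1 cF1]] := eqVneq (phi F1) 0; first by rewrite !mul0r.
    by rewrite -hpsi // ?cF1 ?cF // /cut cF1 cF !eqxx mulrA.
  rewrite -[RHS]add0r -[X in X + _](phid (psi^~ F2)) mulr_sumr -big_split; apply: eq_bigr => F1 _ /=.
  have [->|/sphi[XF1 cF1]] := eqVneq (phi F1) 0; first by rewrite !mul0r mulr0 addr0.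
  by rewrite /bicoboundary mulrDr cF1 mulrCA.
rewrite -mulr_suml => e.
by rewrite [_ / _]mulrC -mulrA -e mulKf.
Qed.
End Bicomplex.
End Join.

(** * Regularity bounds of simplicial complexes *)

Section RegBound.
Variables (K : fieldType) (T : finType).
Implicit Types (D : pred {set T}) (A B F G : {set T}) (p q : nat).

Definition induced D A : pred {set T} := fun F => D F && (F \subset A).

Definition std_acyclic D q := acyclic (@std_sign K T) D q.

(** In view of Hochster's formula, this says that the face ring of the
    restriction of [D] to [A] has regularity at most [p]. *)
Definition reg_le D A p :=
  forall B q, B \subset A -> (p < q)%N -> std_acyclic (induced D B) q.

Lemma induced_down D A : down_closed D -> down_closed (induced D A).
Proof.
move=> dD F G /andP[DF FA] GF; rewrite /induced (dD F) //=.
exact: subset_trans FA.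
Qed.

Lemma reg_le_sub D A B p : A \subset B -> reg_le D B p -> reg_le D A p.
Proof. by move=> AB rB C q CA; apply: rB; apply: subset_trans AB. Qed.

(** The hypothesis on [D] says that its restriction to [A :|: B] is the join of
    its restrictions to [A] and [B]. *)
Lemma join_biacyclic D A B q : [disjoint A & B] ->
  (forall F, F \subset A :|: B -> D F = D (F :&: A) && D (F :&: B)) ->
  std_acyclic (induced D (A :|: B)) q <->
  biacyclic (@std_sign K T) (induced D A) (induced D B) q.
Proof.
move=> dAB joinD; have sT := std_signP K [set: T].
have BA : B \subset ~: A by rewrite -disjoints_subset disjoint_sym.
have eZ F : induced D (A :|: B) F = induced D A (F :&: A) && induced D B (F :\: A).
  rewrite /induced subsetIr andbT subDset.
  have [FAB|] := boolP (F \subset _); last by rewrite !andbF.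
  rewrite !andbT joinD //; congr (_ && D _); apply/setP=> x; rewrite !inE.
  have [xF|] := boolP (x \in F); rewrite ?andbF //= andbT.
  have := subsetP FAB x xF; rewrite inE; have [xA _|_ /= ->//] := boolP (x \in A).
  by apply/negbTE; have := disjointFr dAB xA => ->.
rewrite -(acyclic_joinE (@std_sign K T) q (A := A)); last 2 first.
- by move=> F /andP[].
- by move=> F /andP[_ /subset_trans]; apply.
have jT := join_signP sT A.
split=> ac.
  apply: (eq_acyclic eZ); apply: acyclic_sign sT jT _ ac => F _.
  exact: subsetT.
apply: (eq_acyclic (fun F => esym (eZ F))); apply: acyclic_sign jT sT _ ac => F _.
exact: subsetT.
Qed.

Lemma reg_le_join D A B p1 p2 : down_closed D -> [disjoint A & B] ->
  (forall F, F \subset A :|: B -> D F = D (F :&: A) && D (F :&: B)) ->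
  reg_le D A p1 -> reg_le D B p2 -> reg_le D (A :|: B) (p1 + p2).
Proof.
move=> dD dAB joinD rA rB C q CAB ltq.
have eC : C = C :&: A :|: C :&: B by rewrite -setIUr; apply/esym/setIidPl.
rewrite eC; apply/join_biacyclic.
- apply/pred0P => x /=; rewrite !inE; have [xA|] := boolP (x \in A).
    by rewrite (disjointFr dAB xA) !andbF.
  by rewrite andbF.
- move=> F; rewrite -eC => FC; rewrite joinD; last exact: subset_trans CAB.
  by rewrite !setIA (setIidPl FC).
apply: (biacyclic_upper (std_signP K [set: T]) (p1 := p1) (p2 := p2)) => //.
- exact: induced_down.
- exact: induced_down.
- by move=> r; apply: rA; apply: subsetIr.
- by move=> r; apply: rB; apply: subsetIr.
Qed.

Lemma not_acyclic_join D A B q1 q2 : [disjoint A & B] ->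
  (forall F, F \subset A :|: B -> D F = D (F :&: A) && D (F :&: B)) ->
  ~ std_acyclic (induced D A) q1 -> ~ std_acyclic (induced D B) q2 ->
  ~ std_acyclic (induced D (A :|: B)) (q1 + q2).
Proof.
move=> dAB joinD nA nB /(join_biacyclic _ dAB joinD) bi; apply: nB.
exact: biacyclic_lower nA bi.
Qed.
End RegBound.

Lemma std_acyclic_imset (K : fieldType) (T T' : finType) (f : T -> T')
    (D : pred {set T}) (D' : pred {set T'}) (A : {set T}) q :
  injective f -> (forall F : {set T}, D F = D' (f @: F)) ->
  std_acyclic K (induced D A) q <-> std_acyclic K (induced D' (f @: A)) q.
Proof.
move=> f_inj eD; rewrite /std_acyclic.
apply: (@acyclic_imset K T T' f f_inj _ _ _ _ q) => //; [exact: std_signP|exact: std_signP| |].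
  move=> F; rewrite /induced eD; congr (_ && _); apply/idP/idP; first exact: imsetS.
  move/subsetP => h; apply/subsetP => x xF.
  by rewrite -(mem_imset _ _ f_inj) h // imset_f.
by move=> F' /andP[_ /subset_trans]; apply; apply: imsetS; apply: subsetT.
Qed.

(** * Independence complexes *)

Section Independence.
Variables (K : fieldType) (T : finType) (e : rel T).
Hypotheses (e_sym : ssrbool.symmetric e) (e_irr : irreflexive e).
Implicit Types (A B F : {set T}) (x y : T).

Definition indep : pred {set T} := fun F => [forall x in F, forall y in F, ~~ e x y].

Lemma indepP F : reflect {in F &, forall x y, ~~ e x y} (indep F).
Proof.
apply: (iffP forall_inP) => [h x y xF yF|h x xF]; last by apply/forall_inP => y; apply: h.
by have /forall_inP := h x xF; apply.
Qed.

Lemma indep_down : down_closed indep.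
Proof.
move=> F G /indepP iF /subsetP GF; apply/indepP => x y xG yG.
by apply: iF; apply: GF.
Qed.

(** A disjoint union of graphs has as independence complex a join. *)
Lemma indep_join A B F : {in A & B, forall x y, ~~ e x y} ->
  F \subset A :|: B -> indep F = indep (F :&: A) && indep (F :&: B).
Proof.
move=> nAB FAB; apply/idP/andP => [iF|[/indepP iA /indepP iB]].
  by split; apply: indep_down iF _; rewrite subsetIl.
apply/indepP => x y xF yF.
have := subsetP FAB x xF; have := subsetP FAB y yF; rewrite !inE.
case/orP=> [yA|yB]; case/orP=> [xA|xB]; first by apply: iA; rewrite inE ?xF ?yF.
- by rewrite e_sym; apply: nAB.
- exact: nAB.
- by apply: iB; rewrite inE ?xF ?yF.
Qed.

(** In an independence complex, the link of [x] is the induced complex on the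
    vertices that are neither [x] nor adjacent to [x]. *)
Lemma reg_le_del_link A x p :
  reg_le K indep (A :\ x) p.+1 ->
  reg_le K indep (A :\ x :\: [set y | e x y]) p -> reg_le K indep A p.+1.
Proof.
move=> rD rL B [//|q] BA ltq; have [xB|xB] := boolP (x \in B); last first.
  by apply: rD => //; rewrite subsetD1 BA xB.
apply: (@acyclic_del_link _ _ _ _ x _ (std_signP K setT)).
- exact/induced_down/indep_down.
- apply: eq_acyclic (rD (B :\ x) q.+1 (setSD _ BA) ltq) => F.
  by rewrite /induced subsetD1 -andbA.
apply: eq_acyclic (rL (B :\ x :\: [set y | e x y]) q _ ltq) => [F|]; last first.
  by rewrite setSD // setSD.
rewrite /induced subsetD subsetD1 subUset sub1set xB /=.
have [xF|xF] := boolP (x \in F); rewrite ?andbF //= !andbT.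
have [FB|] := boolP (F \subset B); rewrite ?andbF //= andbT.
rewrite disjoints_subset.
apply/andP/idP => [[/indepP iF /subsetP nF]|/indepP iF].
  apply/indepP => y z.
  have nE t : t \in F -> ~~ e x t by move/nF; rewrite !inE.
  rewrite !inE => /orP[/eqP ->|yF] /orP[/eqP ->|zF]; rewrite ?e_irr ?nE //.
    by rewrite e_sym nE.
  exact: iF.
split; first by apply/indepP => y z yF zF; apply: iF; rewrite !inE ?yF ?zF orbT.
by apply/subsetP => y yF; rewrite !inE; apply: iF; rewrite !inE ?eqxx ?yF ?orbT.
Qed.

(** The independence complex is then a cone with apex [x]. *)
Lemma std_acyclic_isolated A x q : x \in A -> {in A, forall y, ~~ e x y} ->
  std_acyclic K (induced indep A) q.
Proof.
move=> xA nx; apply: (acyclic_cone (k := x)) => [|F /andP[/indepP iF FA]].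
  exact: std_signP.
rewrite /induced subUset sub1set xA FA !andbT; apply/indepP => y z.
have nE t : t \in F -> ~~ e x t by move/(subsetP FA)/nx.
rewrite !inE => /orP[/eqP ->|yF] /orP[/eqP ->|zF]; rewrite ?e_irr ?nE //.
  by rewrite e_sym nE.
exact: iF.
Qed.

Lemma reg_le_edgeless A : {in A &, forall x y, ~~ e x y} -> reg_le K indep A 0.
Proof.
move=> nA B q BA ltq; case: (set_0Vmem B) => [->|[x xB]].
  move=> c _; exists (fun=> 0) => F /andP[_]; rewrite subset0 => /eqP ->.
  by rewrite cards0 => q0; rewrite -q0 in ltq.
apply: (std_acyclic_isolated xB) => y yB; apply: nA; exact: (subsetP BA).
Qed.

(** The independence complex of an edge consists of two points. *)
Lemma not_acyclic_edge x y : e x y -> ~ std_acyclic K (induced indep [set x; y]) 1.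
Proof.
move=> exy ac; have nxy : x != y by apply: contraTneq exy => ->; rewrite e_irr.
have [|w hw] := ac (fun F => (F == [set x])%:R).
  move=> F /andP[/indepP iF Fxy] cF.
  have /eqP eF : F == [set x; y] by rewrite eqEcard Fxy cF cards2 nxy.
  by have := iF x y; rewrite eF !inE !eqxx orbT exy => /(_ isT isT).
have ind1 z : z \in [set x; y] -> induced indep [set x; y] [set z].
  move=> zxy; rewrite /induced sub1set zxy andbT; apply/indepP => a b.
  by rewrite !inE => /eqP -> /eqP ->; rewrite e_irr.
have cob1 z : coboundary (@std_sign K T) w [set z] = std_sign K z set0 * w set0.
  by rewrite /coboundary big_set1 setDv.
have [s1 _] := std_signP K [set: T].
have := hw [set y] (ind1 y _) (cards1 y); rewrite !inE eqxx orbT => /(_ erefl).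
rewrite cob1 (inj_eq set1_inj) eq_sym (negPf nxy) /= => /esym /eqP.
have := hw [set x] (ind1 x _) (cards1 x); rewrite !inE eqxx => /(_ erefl).
rewrite cob1 eqxx /= => e1; rewrite mulf_eq0 => /orP[] /eqP e0.
  have := s1 y set0; rewrite e0 mul0r => /esym/eqP.
  by rewrite oner_eq0.
by move/eqP: e1; rewrite e0 mulr0 oner_eq0.
Qed.
End Independence.

(** * Graded free modules and the Koszul complex *)

Section Graded.
Variables (K : fieldType) (n : nat).
Local Notation S := {mpoly K[n]}.
Implicit Types (p q : S) (m : 'X_{1..n}) (d e : int) (k : 'I_n) (t : {set 'I_n}).

Lemma mcoeffXM k p m :
  ('X_k * p)@_m = if (0 < m k)%N then p@_(m - U_(k)) else 0.
Proof.
rewrite mulrC; case: ifP => mk.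
  have {1}-> : m = (U_(k) + (m - U_(k)))%MM.
    apply/mnmP => i; rewrite mnmDE mnmBE mnm1E; case: eqP => [<-|_]; lia.
  by rewrite mcoeffMX.
apply: memN_msupp_eq0; rewrite (perm_mem (msuppMX p U_(k))).
apply/mapP => -[m' _ em]; move: mk; rewrite em mnmDE mnm1E eqxx; lia.
Qed.

Definition mfilter (P : pred 'X_{1..n}) p : S :=
  \sum_(m <- msupp p | P m) p@_m *: 'X_[m].

Lemma mcoeff_mfilter P p m : (mfilter P p)@_m = if P m then p@_m else 0.
Proof.
rewrite /mfilter raddf_sum /= (eq_bigr (fun m' => p@_m' * (m' == m)%:R)); last first.
  by move=> m' _; rewrite mcoeffZ mcoeffX.
have [mp|mp] := boolP (m \in msupp p); last first.
  rewrite big1_seq ?(memN_msupp_eq0 mp) ?if_same // => m' /andP[_ m'p].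
  by case: eqP m'p mp => [->->//|_ _ _]; rewrite mulr0.
rewrite big_mkcond (bigD1_seq m) ?msupp_uniq //= eqxx mulr1 big1 ?addr0 // => m' /negPf ->.
by rewrite mulr0 if_same.
Qed.

Definition hcomp d p : S := mfilter (fun m => (mdeg m)%:Z == d) p.

Lemma homogP d p : homog_of_deg d p <-> forall m, p@_m != 0 -> (mdeg m)%:Z = d.
Proof. by split=> h m hm; apply: h; move: hm; rewrite mcoeff_msupp. Qed.

Lemma homog0 d : homog_of_deg d (0 : S).
Proof. by move=> m; rewrite msupp0. Qed.

Lemma homogD d p q : homog_of_deg d p -> homog_of_deg d q -> homog_of_deg d (p + q).
Proof.
move=> /homogP hp /homogP hq; apply/homogP => m; rewrite mcoeffD.
by have [->|/hp//] := eqVneq p@_m 0; rewrite add0r; apply: hq.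
Qed.

Lemma homogN d p : homog_of_deg d p -> homog_of_deg d (- p).
Proof. by move=> /homogP hp; apply/homogP => m; rewrite mcoeffN oppr_eq0; apply: hp. Qed.

Lemma homogB d p q : homog_of_deg d p -> homog_of_deg d q -> homog_of_deg d (p - q).
Proof. by move=> hp hq; apply: homogD => //; apply: homogN. Qed.

Lemma homog_sum d (I : Type) (r : seq I) (P : pred I) (F : I -> S) :
  (forall i, P i -> homog_of_deg d (F i)) -> homog_of_deg d (\sum_(i <- r | P i) F i).
Proof.
move=> h; elim/big_ind: _ => //; first exact: homog0.
by move=> x y; apply: homogD.
Qed.

Lemma homogZ d c p : homog_of_deg d p -> homog_of_deg d (c *: p).
Proof.
move=> /homogP hp; apply/homogP => m; rewrite mcoeffZ mulf_eq0 negb_or.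
by case/andP => _; apply: hp.
Qed.

Lemma homogM d e p q : homog_of_deg d p -> homog_of_deg e q -> homog_of_deg (d + e) (p * q).
Proof.
move=> hp hq m /msuppM_le /allpairsP[[m1 m2] /= [/hp h1 /hq h2 ->]].
by rewrite mdegD PoszD h1 h2.
Qed.

Lemma homogX k : homog_of_deg 1 ('X_k : S).
Proof. by move=> m; rewrite msuppX inE => /eqP ->; rewrite mdeg1. Qed.

Lemma hcomp_homog d p : homog_of_deg d (hcomp d p).
Proof. by apply/homogP => m; rewrite mcoeff_mfilter; case: ifP => [/eqP|]; rewrite ?eqxx. Qed.

Lemma hcomp_id d p : homog_of_deg d p -> hcomp d p = p.
Proof.
move=> /homogP hp; apply/mpolyP => m; rewrite mcoeff_mfilter; case: eqP => // ne.
by apply/esym/eqP; apply: contraT => /hp.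
Qed.

Lemma hcompD d p q : hcomp d (p + q) = hcomp d p + hcomp d q.
Proof.
by apply/mpolyP => m; rewrite mcoeffD !mcoeff_mfilter mcoeffD; case: ifP; rewrite ?addr0.
Qed.

Lemma hcomp0 d : hcomp d 0 = 0.
Proof. by apply/mpolyP => m; rewrite mcoeff_mfilter mcoeff0 if_same. Qed.

Lemma hcomp_sum d (I : Type) (r : seq I) (P : pred I) (F : I -> S) :
  hcomp d (\sum_(i <- r | P i) F i) = \sum_(i <- r | P i) hcomp d (F i).
Proof. exact: (big_morph _ (hcompD d) (hcomp0 d)). Qed.

Lemma hcompM d e p q : homog_of_deg e q -> hcomp (d + e) (p * q) = hcomp d p * q.
Proof.
move=> hq; rewrite -{1}(subrK (hcomp d p) p) mulrDl hcompD.
rewrite [X in _ + X]hcomp_id; last by apply: homogM; first exact: hcomp_homog.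
rewrite (_ : hcomp _ _ = 0) ?add0r //; apply/mpolyP => m; rewrite mcoeff0 mcoeff_mfilter.
case: eqP => // dm; apply/memN_msupp_eq0/negP => /msuppM_le /allpairsP[[m1 m2] /= [h1 /hq h2 em]].
move: h1; rewrite mcoeff_msupp mcoeffB mcoeff_mfilter.
have -> : (mdeg m1)%:Z == d by move: dm; rewrite em mdegD PoszD h2 => /addIr ->.
by rewrite subrr eqxx.
Qed.

Section Rows.
Variable r : nat.
Implicit Types (deg : 'I_r -> int) (v w : 'rV[S]_r) (N : 'rV[S]_r -> Prop).
Implicit Types (z : {set 'I_n} -> 'rV[S]_r).

Definition rhomog deg d v := forall l, homog_of_deg (d - deg l) (v 0 l).

Definition rcomp deg d v : 'rV[S]_r := \row_l hcomp (d - deg l) (v 0 l).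

Lemma rhomog0 deg d : rhomog deg d 0.
Proof. by move=> l; rewrite mxE; apply: homog0. Qed.

Lemma rhomogB deg d v w : rhomog deg d v -> rhomog deg d w -> rhomog deg d (v - w).
Proof. by move=> hv hw l; rewrite !mxE; apply: homogB. Qed.

Lemma rhomogD deg d v w : rhomog deg d v -> rhomog deg d w -> rhomog deg d (v + w).
Proof. by move=> hv hw l; rewrite !mxE; apply: homogD. Qed.

Lemma rhomog_sum deg d (I : Type) (s : seq I) (P : pred I) (F : I -> 'rV[S]_r) :
  (forall i, P i -> rhomog deg d (F i)) -> rhomog deg d (\sum_(i <- s | P i) F i).
Proof.
move=> h; elim/big_ind: _ => //; first exact: rhomog0.
by move=> x y; apply: rhomogD.
Qed.

Lemma rhomogZ deg d e p v : homog_of_deg e p -> rhomog deg d v -> rhomog deg (d + e) (p *: v).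
Proof.
move=> hp hv l; rewrite mxE (_ : d + e - deg l = e + (d - deg l)); last by ring.
exact: homogM.
Qed.

Lemma rcomp_homog deg d v : rhomog deg d (rcomp deg d v).
Proof. by move=> l; rewrite mxE; apply: hcomp_homog. Qed.

Lemma rcomp_id deg d v : rhomog deg d v -> rcomp deg d v = v.
Proof. by move=> hv; apply/rowP => l; rewrite mxE hcomp_id. Qed.

Definition submodule N :=
  [/\ N 0, forall v w, N v -> N w -> N (v + w) & forall p v, N v -> N (p *: v)].

Lemma submodB N v w : submodule N -> N v -> N w -> N (v - w).
Proof.
by case=> _ hD hZ Nv Nw; apply: hD => //; rewrite -scaleN1r; apply: hZ.
Qed.

Lemma submod_sum N (I : Type) (s : seq I) (P : pred I) (F : I -> 'rV[S]_r) :
  submodule N -> (forall i, P i -> N (F i)) -> N (\sum_(i <- s | P i) F i).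
Proof. by case=> h0 hD _ h; elim/big_ind: _. Qed.

Definition koszul_coef k (t : {set 'I_n}) : S := std_sign K k t *: 'X_k.

(** The differential of the Koszul complex of [S^r], where the function [z] stands
    for the chain [\sum_t z t * e_t]. *)
Definition koszul (z : {set 'I_n} -> 'rV[S]_r) (t : {set 'I_n}) : 'rV[S]_r :=
  \sum_(k | k \notin t) koszul_coef k t *: z (k |: t).

Lemma koszul_coef_homog k t : homog_of_deg 1 (koszul_coef k t).
Proof. by apply: homogZ; apply: homogX. Qed.

Lemma eq_koszul z z' t : (forall k, k \notin t -> z (k |: t) = z' (k |: t)) ->
  koszul z t = koszul z' t.
Proof. by move=> h; apply: eq_bigr => k /h ->. Qed.

Lemma koszulB z z' t : koszul (fun t => z t - z' t) t = koszul z t - koszul z' t.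
Proof. by rewrite /koszul -sumrB; apply: eq_bigr => k _; rewrite scalerBr. Qed.

Lemma koszulK z t : koszul (koszul z) t = 0.
Proof.
pose a k l := if [&& k \notin t, l \notin t & k != l]
  then (koszul_coef k t * koszul_coef l (k |: t)) *: z (l |: (k |: t)) else 0.
rewrite -[RHS](@sum_antisym _ _ a) => [|k|k l nkl]; last first.
- rewrite /a [l == k]eq_sym nkl !andbT andbC; case: ifP => [/andP[lt kt]|_].
    rewrite setUCA -scaleNr; congr (_ *: _).
    rewrite /koszul_coef -!scalerAl -!scalerAr !scalerA -scaleNr mulrC ['X_l * _]mulrC.
    congr (_ *: _); have [_ sa] := std_signP K [set: 'I_n].
    have := sa k l t (in_setT k) (in_setT l) (subsetT t) nkl kt lt.
    by rewrite [std_sign K l t * _]mulrC => ->; rewrite opprK.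
  by rewrite oppr0.
- by rewrite /a eqxx !andbF.
rewrite /koszul big_mkcond; apply: eq_bigr => k _; rewrite /a.
case: ifP => kt; last by rewrite big1.
rewrite scaler_sumr big_mkcond; apply: eq_bigr => l _.
rewrite !inE negb_or eq_sym andbC; case: ifP => _ //.
by rewrite scalerA.
Qed.

(** Chains of total degree [d]: the basis element [e_t] has degree [#|t|]. *)
Definition homog_chain deg d (z : {set 'I_n} -> 'rV[S]_r) :=
  forall t, rhomog deg (d - #|t|%:Z) (z t).

(** The [i]-th Koszul homology of [S^r / N] is zero in degree [d].  Cycles and
    boundaries are taken modulo [N], so that no quotient module is formed. *)
Definition koszul_acyclic deg N (i : nat) d :=
  forall z, homog_chain deg d z ->
    (forall t, #|t|.+1 = i -> N (koszul z t)) ->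
    exists2 w, homog_chain deg d w & forall t, #|t| = i -> N (z t - koszul w t).

Lemma homog_chain_koszul deg d z : homog_chain deg d z -> homog_chain deg d (koszul z).
Proof.
move=> hz t; apply: rhomog_sum => k kt.
rewrite (_ : d - #|t|%:Z = d - #|k |: t|%:Z + 1); last by rewrite cardsU1 kt; lia.
by apply: rhomogZ; first exact: koszul_coef_homog.
Qed.

Lemma submod_koszul N z t : submodule N -> (forall k, k \notin t -> N (z (k |: t))) -> N (koszul z t).
Proof. by move=> sN h; apply: submod_sum => // k /h; case: sN => _ _; apply. Qed.
End Rows.

Lemma koszul_mul r r' (D : 'M[S]_(r', r)) z t :
  koszul (fun t => z t *m D) t = koszul z t *m D.
Proof. by rewrite /koszul mulmx_suml; apply: eq_bigr => k _; rewrite scalemxAl. Qed.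

Definition graded_mx r r' (deg' : 'I_r' -> int) (deg : 'I_r -> int) (D : 'M[S]_(r', r)) :=
  forall i j, homog_of_deg (deg' i - deg j) (D i j).

Lemma rhomog_mul r r' deg' deg (D : 'M[S]_(r', r)) d v :
  graded_mx deg' deg D -> rhomog deg' d v -> rhomog deg d (v *m D).
Proof.
move=> hD hv l; rewrite mxE; apply: homog_sum => k _.
by rewrite -(subrKA (deg' k) d (- deg l)); apply: homogM.
Qed.

Lemma rcomp_mul r r' deg' deg (D : 'M[S]_(r', r)) d v :
  graded_mx deg' deg D -> rcomp deg d (v *m D) = rcomp deg' d v *m D.
Proof.
move=> hD; apply/rowP => l; rewrite !mxE hcomp_sum; apply: eq_bigr => k _.
by rewrite mxE -(subrKA (deg' k) d (- deg l)) hcompM.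
Qed.

Lemma homog_chain_mul r r' deg' deg (D : 'M[S]_(r', r)) d z :
  graded_mx deg' deg D -> homog_chain deg' d z -> homog_chain deg d (fun t => z t *m D).
Proof. by move=> hD hz t; apply: rhomog_mul hD (hz t). Qed.

End Graded.

Arguments homog_chain_koszul {K n r deg d z} _ t.
Arguments homog_chain_mul {K n r r' deg' deg D d z} _ _ t.
Arguments rhomogB {K n r deg d v w} _ _.
Arguments rhomogD {K n r deg d v w} _ _.
Arguments rcomp_mul {K n r r' deg' deg D} d v _.

(** * Multigraded decomposition and Hochster's formula *)

Section Multigraded.
Variables (K : fieldType) (n : nat).
Local Notation S := {mpoly K[n]}.
Implicit Types (p q : S) (m a : 'X_{1..n}) (d e : int) (k : 'I_n) (t F A : {set 'I_n}).
Implicit Types (D : pred {set 'I_n}) (z w : {set 'I_n} -> S).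
Local Notation sgn := (@std_sign K 'I_n).

Definition mnm_of_set t : 'X_{1..n} := [multinom (i \in t : nat) | i < n].
Definition supp m : {set 'I_n} := [set i | (0 < m i)%N].

Lemma mnm_of_setE t i : mnm_of_set t i = (i \in t).
Proof. exact: mnmE. Qed.

Lemma mnm_of_set_le t a : (mnm_of_set t <= a)%MM = (t \subset supp a).
Proof.
apply/mnm_lepP/subsetP => [h i it|h i]; first by have := h i; rewrite mnm_of_setE it inE.
by rewrite mnm_of_setE; case: (boolP (i \in t)) => // /h; rewrite inE.
Qed.

Lemma mdeg_mnm_of_set t : mdeg (mnm_of_set t) = #|t|.
Proof.
rewrite mdegE -sum1_card [RHS]big_mkcond; apply: eq_bigr => i _.
by rewrite mnm_of_setE; case: (i \in t).
Qed.

Lemma supp_mnm_of_set t : supp (mnm_of_set t) = t.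
Proof. by apply/setP=> i; rewrite inE mnm_of_setE lt0b. Qed.

Definition koszul_poly z t : S := \sum_(k | k \notin t) koszul_coef K k t * z (k |: t).

Lemma koszulE r (z : {set 'I_n} -> 'rV[S]_r) t l : (koszul z t) 0 l = koszul_poly (fun t => z t 0 l) t.
Proof. by rewrite /koszul summxE; apply: eq_bigr => k _; rewrite mxE. Qed.

Lemma mcoeff_koszul_poly z t m :
  (koszul_poly z t)@_m = \sum_(k | (k \notin t) && (0 < m k)%N) sgn k t * (z (k |: t))@_(m - U_(k)).
Proof.
rewrite /koszul_poly raddf_sum [RHS]big_mkcondr; apply: eq_bigr => k _ /=.
by rewrite /koszul_coef -scalerAl mcoeffZ mcoeffXM; case: ifP; rewrite ?mulr0.
Qed.

(** Membership in the Stanley-Reisner ideal of [D]. *)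
Definition nonface D p := forall m, p@_m != 0 -> ~~ D (supp m).

Lemma mpoly_of_coeffs (f : 'X_{1..n} -> K) b :
  exists p, forall m, p@_m = if (mdeg m < b)%N then f m else 0.
Proof.
exists (\sum_(m : 'X_{1..n < b}) f m *: 'X_[m]) => m; case: ltnP => mb.
  by rewrite mcoeff_mpoly.
rewrite raddf_sum /= big1 // => m' _; rewrite mcoeffZ mcoeffX.
case: eqP => [e|_]; last by rewrite mulr0.
by have := bmdeg m'; rewrite e ltnNge mb.
Qed.

(** The component of the chain [z] in multidegree [a] is a boundary.  In
    multidegree [a], the coefficient at [e_t] is a multiple of the monomial
    [a - mnm_of_set t], so only its scalar factor matters. *)
Definition scalar_bound D z (i : nat) a := exists w : {set 'I_n} -> K,
  forall t, #|t| = i -> (mnm_of_set t <= a)%MM -> D (supp (a - mnm_of_set t)) ->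
    (z t)@_(a - mnm_of_set t) = \sum_(k | (k \notin t) && (mnm_of_set (k |: t) <= a)%MM) sgn k t * w (k |: t).

(** Only finitely many multidegrees have total degree [d], so primitives of the
    multigraded components sum up to a polynomial chain. *)
Lemma koszul_boundary_assemble D z i d : (forall t, homog_of_deg (d - #|t|%:Z) (z t)) ->
  (forall a, (mdeg a)%:Z = d -> scalar_bound D z i a) ->
  exists2 w, (forall t, homog_of_deg (d - #|t|%:Z) (w t))
    & forall t, #|t| = i -> nonface D (z t - koszul_poly w t).
Proof.
move=> hz bd.
have /(_ _)/constructive_indefinite_description hW (a : 'X_{1..n}) : exists w : {set 'I_n} -> K,
    (mdeg a)%:Z = d -> forall t, #|t| = i -> (mnm_of_set t <= a)%MM -> D (supp (a - mnm_of_set t)) ->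
    (z t)@_(a - mnm_of_set t) = \sum_(k | (k \notin t) && (mnm_of_set (k |: t) <= a)%MM) sgn k t * w (k |: t).
  have [/bd[w hw]|ne] := eqVneq (mdeg a)%:Z d; first by exists w.
  by exists (fun=> 0) => e; rewrite e eqxx in ne.
pose W a := sval (hW a); have WP a := svalP (hW a).
pose f t m := if (mdeg m)%:Z == d - #|t|%:Z then W (m + mnm_of_set t)%MM t else 0.
have hw t := constructive_indefinite_description _ (mpoly_of_coeffs (f t) `|d|.+1).
pose w t := sval (hw t).
have wE t m : (w t)@_m = f t m.
  rewrite (svalP (hw t)); case: ltnP => //; rewrite /f; case: eqP => // e; lia.
exists w => [t|t ct]; first by apply/homogP => m; rewrite wE /f; case: ifP => [/eqP|_]; rewrite ?eqxx.
move=> m; apply: contraNN => Dm.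
have -> : m = ((m + mnm_of_set t) - mnm_of_set t)%MM by rewrite addmK.
set a := (m + mnm_of_set t)%MM.
have [dm|ndm] := eqVneq (mdeg m)%:Z (d - #|t|%:Z); last first.
  rewrite addmK mcoeffB (_ : (z t)@_m = 0); last first.
    by apply/eqP; apply: contraNT ndm => /((homogP _ _).1 (hz t)) ->.
  rewrite mcoeff_koszul_poly big1 ?subr0 // => k /andP[kt mk]; rewrite wE /f.
  case: eqP => [e|_]; last by rewrite mulr0.
  case/eqP: ndm; move: e; rewrite cardsU1 kt.
  have -> : mdeg m = (mdeg (m - U_(k))%MM).+1; last by lia.
  rewrite -[in LHS](submK (_ : (U_(k) <= m)%MM)) ?mdegD ?mdeg1 ?addn1 //.
  by apply/mnm_lepP => j; rewrite mnm1E; case: eqP => // <-.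
have da : (mdeg a)%:Z = d by rewrite mdegD mdeg_mnm_of_set; lia.
rewrite mcoeffB WP ?addmK //; last by rewrite lem_addl.
rewrite mcoeff_koszul_poly (eq_bigl (fun k => (k \notin t) && (0 < m k)%N)); last first.
  move=> k; have [kt|kt] := boolP (k \in t); rewrite //= mnm_of_set_le.
  apply/subsetP/idP => [/(_ k)|mk j]; rewrite !inE.
    by rewrite eqxx mnmDE mnm_of_setE (negPf kt) addn0 => /(_ isT).
  by rewrite mnmDE mnm_of_setE => /orP[/eqP ->|->]; [rewrite ltn_addr|rewrite addn1].
rewrite -sumrB big1 // => k /andP[kt mk]; rewrite wE /f.
have mE : m = (U_(k) + (m - U_(k)))%MM.
  apply/mnmP => j; rewrite mnmDE mnmBE mnm1E.
  by case: eqP => [<-|_]; [rewrite subnKC | rewrite subn0].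
have -> : (mdeg (m - U_(k)))%:Z == d - #|k |: t|%:Z.
  apply/eqP; rewrite cardsU1 kt add1n; move: dm; rewrite {1}mE mdegD mdeg1.
  set x := mdeg _; set y := #|_|; lia.
suff -> : (m - U_(k) + mnm_of_set (k |: t))%MM = a by rewrite subrr.
apply/mnmP => j; rewrite !mnmDE mnmBE !mnm_of_setE !inE mnm1E eq_sym.
by case: eqP => [->|_]; [rewrite (negPf kt) /= subnK ?addn0 | rewrite subn0].
Qed.

(** The sign of the Koszul complex in squarefree multidegree [A], read on the
    complements [F] in [A] of the Koszul indices. *)
Definition compl_sign A k F : K := sgn k (A :\: (k |: F)).

Lemma compl_signP A : sign_on A (compl_sign A).
Proof.
have [s1 s2] := std_signP K [set: 'I_n]; split=> [k F|k l F kA lA FA nkl kF lF].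
  exact: s1.
have nlk : l != k by rewrite eq_sym.
rewrite /compl_sign; pose G := A :\: (k |: (l |: F)).
have -> : A :\: (k |: F) = l |: G.
  apply/setP=> x; rewrite /G !(in_setD, in_setU1); have [->|nxl] //= := eqVneq x l.
  by rewrite lA (negPf nlk) (negPf lF).
have -> : A :\: (l |: F) = k |: G.
  apply/setP=> x; rewrite /G !(in_setD, in_setU1); have [->|nxk] //= := eqVneq x k.
  by rewrite kA (negPf nkl) (negPf kF).
have kG : k \notin G by rewrite !inE eqxx.
have lG : l \notin G by rewrite !inE eqxx orbT.
have -> : A :\: (k |: (l |: F)) = G by [].
have -> : A :\: (l |: (k |: F)) = G by rewrite setUCA.
have := s2 k l G (in_setT k) (in_setT l) (subsetT _) nkl kG lG.
by rewrite mulrC => ->; rewrite opprK mulrC.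
Qed.

(** Multidegree [a] of the Koszul complex of the face ring of [D] is the cochain
    complex of this simplicial complex: the Koszul index [t] corresponds to the
    face [supp a :\: t], present when the monomial at [t] is nonzero. *)
Definition multideg_complex D a : pred {set 'I_n} :=
  fun F => (F \subset supp a) && D (supp (a - mnm_of_set (supp a :\: F))).

Lemma acyclic_scalar_bound D z i a :
  (forall t, #|t|.+1 = i -> nonface D (koszul_poly z t)) ->
  ((i <= #|supp a|)%N -> std_acyclic K (multideg_complex D a) (#|supp a| - i)) ->
  scalar_bound D z i a.
Proof.
set A := supp a => cz; have [leiA|ltAi] := leqP i #|A|; last first.
  move=> _; exists (fun=> 0) => t ct; rewrite mnm_of_set_le => /subset_leq_card.
  by rewrite ct leqNgt ltAi.
move=> /(_ isT) ac; set q := (#|A| - i)%N in ac.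
pose s := compl_sign A.
have sA : sign_on A s := compl_signP A.
have XA F : multideg_complex D a F -> F \subset A by case/andP.
have acs := acyclic_sign (std_signP K A) sA XA ac.
have [|w hw] := acs (fun F => (z (A :\: F))@_(a - mnm_of_set (A :\: F))).
  move=> F /andP[FA DF] cF; set t := A :\: F in DF.
  have ct : #|t|.+1 = i.
    have := subset_leq_card FA; rewrite /t cardsD (setIidPr FA) cF /q.
    by move: leiA; move: #|A| => b; clear; lia.
  have <- : (koszul_poly z t)@_(a - mnm_of_set t) = 0.
    by apply/eqP; apply: contraTT DF; apply: cz.
  rewrite mcoeff_koszul_poly /coboundary; apply: eq_big => k.
    rewrite mnmBE mnm_of_setE !inE; have [kF|kF] := boolP (k \in F) => /=.
      by have := subsetP FA k kF; rewrite inE; lia.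
    by case: (posnP (a k)) => [->|].
  move=> kF; have kA : k \in A := subsetP FA k kF.
  have kt : k \notin t by rewrite inE kF.
  have et : A :\: (F :\ k) = k |: t.
    apply/setP=> x; rewrite /t !(in_setD, in_set1, in_setU1).
    by have [->|//] := eqVneq x k.
  rewrite /s /compl_sign setD1K // et; congr (_ * _@__); apply/mnmP => j.
  rewrite !mnmBE !mnm_of_setE mnm1E in_setU1 eq_sym.
  by case: eqVneq => [<-|_]; rewrite /= ?(negPf kt) ?subn0.
exists (fun t => w (A :\: t)) => t ct; rewrite mnm_of_set_le => tA Dt.
have tAA : A :\: (A :\: t) = t by rewrite setDDr setDv set0U; apply/setIidPr.
have XAt : multideg_complex D a (A :\: t).
  by rewrite /multideg_complex [supp a :\: _]tAA subsetDl.
have := hw _ XAt; rewrite tAA => ->; last by rewrite cardsD (setIidPr tA) ct.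
rewrite /coboundary; apply: eq_big => k.
  rewrite inE mnm_of_set_le subUset sub1set -/A tA andbT; by case: (k \in t).
move=> kAt; rewrite /s /compl_sign setD1K // tAA; congr (_ * w _).
by rewrite setDDl setUC.
Qed.

End Multigraded.

Section Koszul.
Variables (K : fieldType) (n : nat).
Local Notation S := {mpoly K[n]}.
Implicit Types (p q : S) (m a : 'X_{1..n}) (d e : int) (k : 'I_n) (t F A : {set 'I_n}).
Implicit Types (D : pred {set 'I_n}).
Local Notation sgn := (@std_sign K 'I_n).

(** The full simplex is a cone in every multidegree except 0.  In multidegree 0
    only the constant terms in homological degree 0 survive, and these are assumed
    to vanish. *)
Lemma koszul_exact r (deg : 'I_r -> int) (i : nat) d (z : {set 'I_n} -> 'rV[S]_r) :
  homog_chain deg d z -> (forall t, #|t|.+1 = i -> koszul z t = 0) ->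
  (i = 0%N -> forall l, (z set0 0 l)@_0%MM = 0) ->
  exists2 w, homog_chain deg d w & forall t, #|t| = i -> z t = koszul w t.
Proof.
move=> hz cz z0; pose D : pred {set 'I_n} := predT.
have ND p : nonface D p -> p = 0.
  move=> h; apply/mpolyP => m; rewrite mcoeff0; apply/eqP.
  by apply: contraT => /h.
have /(_ _)/constructive_indefinite_description hw (l : 'I_r) :
    exists w : {set 'I_n} -> S, (forall t, homog_of_deg (d - #|t|%:Z - deg l) (w t)) /\
      forall t, #|t| = i -> z t 0 l = koszul_poly w t.
  have dE t : d - #|t|%:Z - deg l = d - deg l - #|t|%:Z by rewrite addrAC.
  have [||w hw1 hw2] := @koszul_boundary_assemble K n D (fun t => z t 0 l) i (d - deg l).
  - by move=> t; rewrite -dE; apply: hz.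
  - move=> a _; have [a0|/eqP an0] := eqVneq (supp a) set0.
      exists (fun=> 0) => t ct; rewrite mnm_of_set_le a0 subset0 => /eqP t0 _.
      rewrite [RHS]big1 => [|k _]; last by rewrite mulr0.
      have -> : (a - mnm_of_set t)%MM = 0%MM.
        apply/mnmP => j; rewrite mnmBE mnm0E mnm_of_setE t0 inE subn0; apply/eqP.
        by move/setP/(_ j): a0; rewrite !inE lt0n => /negbFE.
      by rewrite t0; apply: z0; rewrite -ct t0 cards0.
    have [k ka] : exists k, k \in supp a by apply/set0Pn/eqP.
    apply: acyclic_scalar_bound => [t ct|_].
      by move=> m; rewrite -koszulE cz // mxE mcoeff0 eqxx.
    apply: (acyclic_cone (k := k)) => [|F /andP[FA _]]; first exact: std_signP.
    by rewrite /multideg_complex subUset sub1set ka FA.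
  exists w; split=> t; first by rewrite dE.
  by move=> ct; apply/eqP; rewrite -subr_eq0; apply/eqP/ND/hw2.
exists (fun t => \row_l sval (hw l) t) => [t l|t ct].
  by rewrite mxE; apply: (svalP (hw l)).1.
apply/rowP => l; rewrite koszulE (svalP (hw l)).2 //.
by apply: eq_bigr => k _; rewrite mxE.
Qed.

Definition face_ideal D (v : 'rV[S]_1) := nonface D (v 0 0).

Lemma supp_sub_mnm_of_set a A : A \subset supp a ->
  supp (a - mnm_of_set A) = (supp a :\: A) :|: [set k | (1 < a k)%N].
Proof.
move=> /subsetP Aa; apply/setP=> k; rewrite !inE mnmBE mnm_of_setE.
have := Aa k; rewrite inE; case: (k \in A) => /= [/(_ isT)|_]; first by rewrite subn1; lia.
by rewrite subn0; apply/idP/idP => [->//|]; lia.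
Qed.

(** In a multidegree [a] with [1 < a k], the multidegree complex is a cone with
    apex [k]; in squarefree multidegree [A] it is the restriction of [D] to [A],
    in complementary degree. *)
Lemma koszul_acyclic_face D (i : nat) d : down_closed D ->
  koszul_acyclic (fun _ : 'I_1 => 0) (face_ideal D) i d <->
  forall A, #|A|%:Z = d -> (i <= #|A|)%N -> std_acyclic K (induced D A) (#|A| - i).
Proof.
move=> dD; split=> [kv A cA iA|acA z hz cz].
  set q := (#|A| - i)%N; have sA := compl_signP K A.
  have XA F : induced D A F -> F \subset A by case/andP.
  apply: (acyclic_sign sA (std_signP K A) XA) => c cc.
  pose z t : S := if t \subset A then c (A :\: t) *: 'X_[mnm_of_set (A :\: t)] else 0.
  have zE t m : (z t)@_m = if (t \subset A) && (m == mnm_of_set (A :\: t)) then c (A :\: t) else 0.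
    rewrite /z; case: ifP => _; rewrite ?mcoeff0 //= mcoeffZ mcoeffX eq_sym.
    by case: eqP; rewrite ?mulr1 ?mulr0.
  have cmp F k : k \in F -> F \subset A -> A :\: (F :\ k) = k |: (A :\: F).
    move=> kF FA; apply/setP=> x; rewrite !(in_setD, in_set1, in_setU1).
    by have [->|//] := eqVneq x k; rewrite (subsetP FA).
  have mcmp F k : k \in F -> (mnm_of_set F - U_(k))%MM = mnm_of_set (F :\ k).
    move=> kF; apply/mnmP => j; rewrite mnmBE mnm1E !mnm_of_setE !inE eq_sym.
    by have [->|_] := eqVneq j k; rewrite ?kF ?subn0.
  have cplK F : F \subset A -> A :\: (A :\: F) = F.
    by move=> FA; rewrite setDDr setDv set0U; apply/setIidPr.
  have [||w _ hw] := kv (fun t => const_mx (z t)).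
  - move=> t l; rewrite mxE; apply/homogP => m; rewrite zE.
    case: ifP => [/andP[tA /eqP ->] _|_]; last by rewrite eqxx.
    rewrite mdeg_mnm_of_set cardsD (setIidPr tA) -cA subr0.
    by have := subset_leq_card tA; lia.
  - move=> t ct m; rewrite koszulE mcoeff_koszul_poly; apply: contraNN => Dm.
    have [/andP[tA /eqP em]|nt] := boolP ((t \subset A) && (m == mnm_of_set (A :\: t))); last first.
      rewrite big1 // => k /andP[kt mk]; rewrite mxE zE.
      case: ifP => [/andP[]|_]; last by rewrite mulr0.
      rewrite subUset sub1set => /andP[kA tA] /eqP e.
      case/negP: nt; rewrite tA /=; apply/eqP/mnmP => j.
      move/mnmP/(_ j): e; rewrite mnmBE mnm1E !mnm_of_setE !inE eq_sym.
      have [->|_] := eqVneq j k; rewrite ?kA ?kt ?subn0 //=.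
      by move/eqP; rewrite subn_eq0 => h; apply/eqP; rewrite eqn_leq h.
    apply/eqP; rewrite -[RHS](cc (A :\: t)); last 2 first.
    + by rewrite /induced subsetDl andbT; move: Dm; rewrite em supp_mnm_of_set.
    + by rewrite cardsD (setIidPr tA) /q; have := subset_leq_card tA; lia.
    apply: eq_big => k.
      by rewrite em mnm_of_setE lt0b inE; case: (k \in t).
    rewrite em mnm_of_setE lt0b => /andP[kt kAt]; rewrite mxE zE mcmp // /compl_sign setD1K //.
    have kA : k \in A by move: kAt; rewrite inE => /andP[].
    rewrite setDDl setUC subUset sub1set kA tA eqxx /= cplK //.
  exists (fun G => (w (A :\: G) 0 0)@_(mnm_of_set G)) => F /andP[DF FA] cF.
  have := hw (A :\: F); rewrite cardsD (setIidPr FA) cF /q subKn // => /(_ erefl).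
  move/(_ (mnm_of_set F)); rewrite supp_mnm_of_set DF !mxE mcoeffB zE subsetDl cplK // eqxx /=.
  rewrite koszulE mcoeff_koszul_poly subr_eq0; case: eqP => [->|_ /(_ isT)//] _.
  apply: eq_big => k; rewrite ?mnm_of_setE ?lt0b inE.
    by case: (k \in F); rewrite ?andbF.
  move=> /andP[kt kF]; rewrite /compl_sign setD1K // mcmp // cmp //.
have [||w hw1 hw2] := @koszul_boundary_assemble K n D (fun t => z t 0 0) i d.
- by move=> t; have := hz t 0; rewrite subr0.
- move=> a da; apply: acyclic_scalar_bound => [t ct|ia].
    by rewrite -koszulE; apply: cz.
  have [k ak|sqf] := pickP (fun k => 1 < a k)%N.
    apply: (acyclic_cone (k := k)) => [|F /andP[FA DF]]; first exact: std_signP.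
    have ka : k \in supp a by rewrite inE ltnW.
    rewrite /multideg_complex subUset sub1set ka FA /=.
    move: DF; rewrite !supp_sub_mnm_of_set ?subsetDl //; congr (D _).
    apply/setP=> j; rewrite !inE.
    by have [->|//] := eqVneq j k; rewrite ak !orbT.
  have aE : a = mnm_of_set (supp a).
    by apply/mnmP => j; rewrite mnm_of_setE inE; have := sqf j; lia.
  have cA : #|supp a|%:Z = d by rewrite -da {2}aE mdeg_mnm_of_set.
  apply: eq_acyclic (acA _ cA ia) => F; rewrite /induced /multideg_complex andbC.
  have [FA|//] := boolP (F \subset supp a); rewrite supp_sub_mnm_of_set ?subsetDl //=.
  rewrite setDDr setDv set0U (setIidPr FA) (_ : [set k | _] = set0) ?setU0 //.
  by apply/setP=> j; rewrite !inE sqf.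
exists (fun t => const_mx (w t)) => [t l|t ct].
  by rewrite mxE subr0.
rewrite /face_ideal !mxE koszulE (_ : koszul_poly _ t = koszul_poly w t); first exact: hw2.
by apply: eq_bigr => k _; rewrite mxE.
Qed.
End Koszul.

(** * Koszul homology along a free resolution *)

Lemma choose_fun (A B : Type) (P : A -> B -> Prop) :
  (forall a, exists b, P a b) -> exists f, forall a, P a (f a).
Proof.
move=> h; exists (fun a => sval (constructive_indefinite_description _ (h a))) => a.
exact: svalP (constructive_indefinite_description _ (h a)).
Qed.

Section Step.
Variables (K : fieldType) (n : nat).
Local Notation S := {mpoly K[n]}.
Implicit Types (d e : int) (t : {set 'I_n}).

Definition in_irrelevant r (v : 'rV[S]_r) := forall l, (v 0 l)@_0%MM = 0.

Lemma in_irrelevant_mul r r' (D : 'M[S]_(r', r)) v :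
  (forall k l, (D k l)@_0%MM = 0) -> in_irrelevant (v *m D).
Proof.
move=> D0 l; rewrite mxE raddf_sum /= big1 // => k _.
by rewrite (rmorphM (mcoeff 0%MM)) /= D0 mulr0.
Qed.

Lemma in_irrelevant_koszul r (z : {set 'I_n} -> 'rV[S]_r) t : in_irrelevant (koszul z t).
Proof.
move=> l; rewrite koszulE /koszul_poly raddf_sum /= big1 // => k _.
by rewrite /koszul_coef -scalerAl mcoeffZ mcoeffXM mnm0E mulr0.
Qed.

Lemma image_homog r r' deg' deg (D : 'M[S]_(r', r)) d v : graded_mx deg' deg D ->
  rhomog deg d v -> (exists y, v = y *m D) -> exists2 y, rhomog deg' d y & v = y *m D.
Proof.
move=> gD hv [y vE]; exists (rcomp deg' d y); first exact: rcomp_homog.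
by rewrite -(rcomp_mul d y gD) -vE rcomp_id.
Qed.

(** With [S^r' / N'] isomorphic to [N] through [D], this is the connecting map of
    the long exact sequence of [0 -> N -> S^r -> S^r / N -> 0].  It is bijective
    because the Koszul homology of [S^r] vanishes in positive degrees; for [i = 0]
    minimality is needed, to know that the image of [D] consists of boundaries. *)
Lemma koszul_acyclic_syzygies r r' (deg : 'I_r -> int) (deg' : 'I_r' -> int) (D : 'M[S]_(r', r))
    (N : 'rV[S]_r -> Prop) (N' : 'rV[S]_r' -> Prop) (i : nat) d :
  graded_mx deg' deg D -> (forall k l, (D k l)@_0%MM = 0) ->
  (forall v, N v <-> exists w, v = w *m D) ->
  (forall v, N' v <-> v *m D = 0) ->
  koszul_acyclic deg N i.+1 d <-> koszul_acyclic deg' N' i d.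
Proof.
move=> gD D0 NE N'E; split=> kv.
  move=> y hy cy.
  have [||_|z hz zE] := @koszul_exact K n r deg i d (fun t => y t *m D).
  - exact: homog_chain_mul gD hy.
  - by move=> t ct; rewrite koszul_mul; apply/N'E/cy.
  - exact: in_irrelevant_mul.
  have [|w hw wE] := kv z hz.
    by move=> t [ct]; apply/NE; exists (y t); rewrite zE.
  have /choose_fun[x hx] t : exists x, rhomog deg' (d - #|t|%:Z) x /\
      (#|t| = i.+1 -> z t - koszul w t = x *m D).
    have [ct|nct] := eqVneq #|t| i.+1; last first.
      by exists 0; split; [apply: rhomog0 | move=> e; rewrite e eqxx in nct].
    have [x hx xE] := image_homog gD (rhomogB (hz t) (homog_chain_koszul hw t)) ((NE _).1 (wE t ct)).
    by exists x.
  exists x => [t|t ct]; first by have [] := hx t.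
  apply/N'E; rewrite mulmxBl -koszul_mul zE //.
  have -> : koszul z t = koszul (fun t => z t - koszul w t) t by rewrite koszulB koszulK subr0.
  rewrite (eq_koszul (z' := fun t => x t *m D)) ?subrr // => k kt.
  by rewrite (hx (k |: t)).2 // cardsU1 kt ct.
move=> z hz cz.
have /choose_fun[y hy] t : exists y, rhomog deg' (d - #|t|%:Z) y /\
    (#|t| = i -> koszul z t = y *m D).
  have [ct|nct] := eqVneq #|t| i; last first.
    by exists 0; split; [apply: rhomog0 | move=> e; rewrite e eqxx in nct].
  have cti : #|t|.+1 = i.+1 by rewrite ct.
  have [y hy yE] := image_homog gD (homog_chain_koszul hz t) ((NE _).1 (cz t cti)).
  by exists y.
have hyc : homog_chain deg' d y by move=> t; have [] := hy t.
have [|w hw wE] := kv y hyc.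
  move=> t ct; apply/N'E; rewrite -koszul_mul -[RHS](koszulK z t); apply: eq_koszul => k kt.
  by rewrite -(hy _).2 // cardsU1 kt add1n.
have [|||x hx xE] := @koszul_exact K n r deg i.+1 d (fun t => z t - w t *m D).
- by move=> t; apply: rhomogB; [apply: hz | apply: (homog_chain_mul gD hw)].
- move=> t [ct]; rewrite koszulB (hy _).2 // koszul_mul -mulmxBl; apply/N'E/wE => //.
- by [].
exists x => // t ct; apply/NE; exists (w t).
by rewrite -xE // opprB addrC subrK.
Qed.

Definition graded_sub r (deg : 'I_r -> int) (N : 'rV[S]_r -> Prop) :=
  forall d v, N v -> N (rcomp deg d v).

Lemma rcompB r (deg : 'I_r -> int) d (v w : 'rV[S]_r) :
  rcomp deg d (v - w) = rcomp deg d v - rcomp deg d w.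
Proof.
apply/rowP => l; rewrite !mxE hcompD; congr (_ + _).
by apply/mpolyP => m; rewrite mcoeffN !mcoeff_mfilter mcoeffN; case: ifP; rewrite ?oppr0.
Qed.

(** [D] induces an isomorphism from [S^r / N] to [S^r0 / N0]. *)
Lemma koszul_acyclic_augment r r0 (deg : 'I_r -> int) (deg0 : 'I_r0 -> int) (D : 'M[S]_(r, r0))
    (N : 'rV[S]_r -> Prop) (N0 : 'rV[S]_r0 -> Prop) (i : nat) d :
  graded_mx deg deg0 D -> submodule N0 -> graded_sub deg0 N0 ->
  (forall p, exists v, N0 (p - v *m D)) -> (forall v, N v <-> N0 (v *m D)) ->
  koszul_acyclic deg N i d <-> koszul_acyclic deg0 N0 i d.
Proof.
move=> gD sN0 gN0 surj NE.
have lift (z : {set 'I_n} -> 'rV[S]_r0) : homog_chain deg0 d z ->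
    exists2 y, homog_chain deg d y & forall t, N0 (z t - y t *m D).
  move=> hz; have /choose_fun[y hy] t : exists y, rhomog deg (d - #|t|%:Z) y /\ N0 (z t - y *m D).
    have [y yE] := surj (z t); exists (rcomp deg (d - #|t|%:Z) y).
    split; first exact: rcomp_homog.
    by have := gN0 (d - #|t|%:Z) _ yE; rewrite rcompB (rcomp_mul _ _ gD) rcomp_id.
  by exists y => t; have [] := hy t.
split=> kv z hz cz.
  have [y hy yE] := lift z hz; have [|w hw wE] := kv y hy.
    move=> t ct; apply/NE; rewrite -koszul_mul -[koszul _ t](subKr (koszul z t)).
    apply: submodB (cz t ct) _ => //; rewrite -koszulB.
    by apply: submod_koszul => // k _; apply: yE.
  exists (fun t => w t *m D) => [|t ct]; first exact: homog_chain_mul gD hw.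
  rewrite koszul_mul -(subrKA (y t *m D)) -mulmxBl.
  by case: sN0 => _ hD _; apply: hD; [apply: yE | apply/NE/wE].
have [|w hw wE] := kv _ (homog_chain_mul gD hz).
  by move=> t ct; rewrite koszul_mul; apply/NE/cz.
have [y hy yE] := lift w hw; exists y => // t ct; apply/NE.
rewrite mulmxBl -koszul_mul -(subrKA (koszul w t)); case: (sN0) => _ hD _; apply: hD.
  exact: wE.
by rewrite -koszulB; apply: submod_koszul => // k _; apply: yE.
Qed.

(** If [N] is contained in the irrelevant ideal times [S^r], the zeroth Koszul
    homology of [S^r / N] is the vector space on the basis of [S^r]. *)
Lemma koszul_acyclic0 r (deg : 'I_r -> int) (N : 'rV[S]_r -> Prop) d :
  N 0 -> (forall v, N v -> in_irrelevant v) -> koszul_acyclic deg N 0 d <-> forall k, deg k <> d.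
Proof.
move=> N0 Nm; split=> [kv k dk|nd z hz _].
  pose z t : 'rV[S]_r := if t == set0 then delta_mx 0 k else 0.
  have [||w _ hw] := kv z.
  - move=> t l; rewrite /z; case: eqP => [->|_]; last by rewrite mxE; apply: homog0.
    rewrite cards0 subr0 mxE eqxx /=; case: eqP => [->|_]; last exact: homog0.
    by move=> m; rewrite msupp1 inE dk subrr => /eqP ->; rewrite mdeg0.
  - by [].
  have := Nm _ (hw set0 (cards0 _)) k; rewrite !mxE mcoeffB in_irrelevant_koszul subr0 /z eqxx mxE.
  by rewrite !eqxx mcoeff1 eqxx => /eqP; rewrite oner_eq0.
have [||_ l|w hw wE] := @koszul_exact K n r deg 0 d z => //.
  have /homogP h := hz set0 l; apply/eqP; apply: contraT => /h.
  by rewrite mdeg0 cards0 subr0 => /esym /eqP; rewrite subr_eq0 => /eqP /esym /nd.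
by exists w => // t ct; rewrite wE ?subrr.
Qed.
End Step.

(** * Minimal generators of a module of relations *)

Lemma rowspan_family (K : fieldType) (M : nat) (P : 'rV[K]_M -> Prop) :
  exists (s : nat) (A : 'M[K]_(s, M)),
    (forall i, P (row i A)) /\ forall u, P u -> (u <= A)%MS.
Proof.
suff: forall k s (A : 'M[K]_(s, M)), (forall i, P (row i A)) -> (M - \rank A <= k)%N ->
    exists (s : nat) (A : 'M[K]_(s, M)),
      (forall i, P (row i A)) /\ forall u, P u -> (u <= A)%MS.
  by move=> H; apply: (H _ _ (0 : 'M[K]_(0, M))) (leqnn _) => -[].
elim=> [|k IH] s A PA rA.
  exists s, A; split=> // u _; apply: submx_full; rewrite /row_full eqn_leq rank_leq_col.
  by rewrite -subn_eq0 -leqn0.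
have [max|/Classical_Pred_Type.not_all_ex_not[u nu]] :=
    Classical_Prop.classic (forall u, P u -> (u <= A)%MS); first by exists s, A.
have [Pu nuA] : P u /\ ~~ (u <= A)%MS.
  by split; [|apply/negP => uA]; apply: Classical_Prop.NNPP => h; apply: nu => // /h.
apply: (IH _ (col_mx A u)).
  move=> i; case: (split_ordP i) => j ->; first by rewrite rowKu.
  by rewrite rowKd row_id.
have : (\rank A < \rank (col_mx A u))%N.
  have sub : (A <= col_mx A u)%MS.
    by have := submx_refl (col_mx A u); rewrite col_mx_sub => /andP[].
  by rewrite (ltn_leqif (mxrank_leqif_sup sub)) col_mx_sub negb_and nuA orbT.
by have := rank_leq_col (col_mx A u); lia.
Qed.

Lemma least_nat (P : nat -> Prop) : (exists i, P i) ->
  exists i, P i /\ forall j, P j -> (i <= j)%N.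
Proof.
move=> [i Pi]; elim/ltn_ind: i Pi => i IH Pi.
have [[j [Pj ji]]|nj] := Classical_Prop.classic (exists j, P j /\ (j < i)%N).
  exact: IH ji Pj.
exists i; split=> // j Pj; rewrite leqNgt; apply/negP => ji.
by apply: nj; exists j.
Qed.

Section Existence.
Variables (K : fieldType) (n : nat).
Local Notation S := {mpoly K[n]}.
Implicit Types (d e : int) (t : {set 'I_n}).

Section Generators.
Variables (r : nat) (deg : 'I_r -> int) (N : 'rV[S]_r -> Prop).
Implicit Types (v : 'rV[S]_r).
Hypotheses (sN : submodule N) (gN : graded_sub deg N) (mN : forall v, N v -> in_irrelevant v).

Definition generates (P : 'rV[S]_r -> Prop) r' (deg' : 'I_r' -> int) (D : 'M[S]_(r', r)) :=
  [/\ graded_mx deg' deg D, forall i, N (row i D)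
    & forall v, N v -> P v -> exists w, v = w *m D].

(** The elements of degree [d] are determined by finitely many coefficients. *)
Lemma generates_degree d : exists r' (deg' : 'I_r' -> int) D,
  generates (rhomog deg d) deg' D.
Proof.
pose b := (\sum_l `|d - deg l|).+1.
pose I := ('I_r * 'X_{1..n < b})%type.
pose phi (v : 'rV[S]_r) : 'rV[K]_#|{: I}| :=
  \row_(j < #|{: I}|) (v 0 (enum_val j : I).1)@_(bmnm (enum_val j : I).2).
have [s [A [PA spanA]]] := rowspan_family (fun u => exists v, [/\ N v, rhomog deg d v & phi v = u]).
have /choose_fun[g hg] := PA.
exists s, (fun=> d), (\matrix_(i, j) g i 0 j); split.
- by move=> i j; rewrite mxE; have [_ hv _] := hg i; apply: hv.
- move=> i; have [gi _ _] := hg i; rewrite (_ : row i _ = g i) //.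
  by apply/rowP => j; rewrite !mxE.
move=> v Nv hv; have /submxP[c cE] := spanA (phi v) (ex_intro _ v (And3 Nv hv erefl)).
exists (\row_i (c 0 i)%:MP); apply/rowP => l; apply/eqP; rewrite -subr_eq0.
set x := _ - _; have hx : homog_of_deg (d - deg l) x.
  apply: homogB; first exact: hv.
  rewrite mxE; apply: homog_sum => i _; rewrite !mxE mul_mpolyC; apply: homogZ.
  by have [_ hgi _] := hg i; apply: hgi.
apply/eqP/mpolyP => m; rewrite mcoeff0; apply/eqP; apply: contraT => xm.
have hm := (homogP _ _).1 hx m xm.
have mb : (mdeg m < b)%N by rewrite ltnS (bigD1 l) //= -hm absz_nat leq_addr.
pose j := enum_rank ((l, BMultinom mb) : I).
have phij u : phi u 0 j = (u 0 l)@_m by rewrite mxE enum_rankK.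
case/eqP: xm; rewrite mcoeffB -phij cE !mxE raddf_sum /= -sumrB big1 // => i _.
by rewrite !mxE mul_mpolyC mcoeffZ -phij; have [_ _ ->] := hg i; rewrite mxE subrr.
Qed.

Lemma generates_sum P1 P2 r1 r2 (deg1 : 'I_r1 -> int) (deg2 : 'I_r2 -> int) D1 D2 :
  generates P1 deg1 D1 -> generates P2 deg2 D2 ->
  exists r' (deg' : 'I_r' -> int) D, generates (fun v => P1 v \/ P2 v) deg' D.
Proof.
move=> [g1 N1 s1] [g2 N2 s2].
exists (r1 + r2)%N, (fun i => match split i with inl i => deg1 i | inr i => deg2 i end), (col_mx D1 D2).
split=> [i j|i|v Nv [/(s1 v Nv)[w ->]|/(s2 v Nv)[w ->]]].
- by case: (split_ordP i) => k ->; rewrite ?col_mxEu ?col_mxEd; [apply: g1|apply: g2].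
- by case: (split_ordP i) => k ->; rewrite ?rowKu ?rowKd.
- by exists (row_mx w 0); rewrite mul_row_col mul0mx addr0.
- by exists (row_mx 0 w); rewrite mul_row_col mul0mx add0r.
Qed.

Variable B : int.
Hypothesis kvB : forall d, B < d -> koszul_acyclic deg N 1 d.

(** A lower bound of the degrees of nonzero homogeneous elements. *)
Definition low : int := - (\sum_l `|deg l|)%N%:Z.

Lemma low_le l : low <= deg l.
Proof. by rewrite /low (bigD1 l) //=; lia. Qed.

Lemma rhomog_low d v : d < low -> rhomog deg d v -> v = 0.
Proof.
move=> dl hv; apply/rowP => l; apply/mpolyP => m; rewrite mxE mcoeff0; apply/eqP.
by apply: contraT => /((homogP _ _).1 (hv l)); have := low_le l; lia.
Qed.

Lemma rcomp_sum v : exists M, v = \sum_(j < M) rcomp deg (low + j%:Z) v.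
Proof.
exists (\sum_l (msize (v 0%R l) + `|deg l - low|))%N.
set M := (\sum_l _)%N; apply/rowP => l; rewrite summxE; apply/mpolyP => m.
rewrite raddf_sum /=; under eq_bigr => j _ do rewrite mxE mcoeff_mfilter.
have [->|nz] := eqVneq (v 0 l)@_m 0; first by rewrite big1 // => j _; rewrite if_same.
have jM : (`|((mdeg m)%:Z + deg l - low)%R|%N < M)%N.
  have := msize_mdeg_lt (_ : m \in msupp (v 0 l)); rewrite mcoeff_msupp nz => /(_ isT).
  by have := low_le l; rewrite /M (bigD1 l) //=; lia.
rewrite (bigD1 (Ordinal jM)) //= big1 => [|j].
  by rewrite addr0 ifT //; apply/eqP; have := low_le l; lia.
rewrite -val_eqE /= => nj; case: ifP => // /eqP e; case/eqP: nj.
by have := low_le l; lia.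
Qed.

(** Degrees up to [B] contribute finitely many generators.  In a degree above
    [B], an element [v] of [N] is a Koszul boundary [koszul z set0], since its
    entries have no constant term; then [z] is a 1-cycle modulo [N], hence
    homologous to a chain with entries in [N], and [v] is a combination of
    elements of [N] of smaller degree. *)
Lemma exists_generators : exists r' (deg' : 'I_r' -> int) D,
  graded_mx deg' deg D /\ forall v, N v <-> exists w, v = w *m D.
Proof.
have [r' [deg' [D [gD ND spanD]]]] : exists r' (deg' : 'I_r' -> int) D,
    generates (fun v : 'rV[S]_r => exists2 d, d <= B & rhomog deg d v) deg' D.
  pose Q (j : nat) (v : 'rV[S]_r) := exists2 d, B - j%:Z < d <= B & rhomog deg d v.
  have step j : exists r' (deg' : 'I_r' -> int) D, generates (Q j) deg' D.
    elim: j => [|j [r1 [deg1 [D1 g1]]]].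
      exists 0%N, (fun=> 0), 0; split=> [[]//|[]//|v _ [d]]. lia.
    have [r2 [deg2 [D2 g2]]] := generates_degree (B - j%:Z).
    have [r' [deg' [D [g3 N3 s3]]]] := generates_sum g1 g2.
    exists r', deg', D; split=> // v Nv [d dB hv]; apply: s3 => //.
    have [e|ne] := eqVneq d (B - j%:Z); first by right; rewrite -e.
    by left; exists d => //; lia.
  have [r' [deg' [D [gD ND sD]]]] := step `|B - low|.+1.
  exists r', deg', D; split=> // v Nv [d dB hv].
  have [dl|ld] := ltP d low; last by apply: sD => //; exists d => //; lia.
  by exists 0; rewrite mul0mx (rhomog_low dl hv).
have NwD w : N (w *m D).
  rewrite mulmx_sum_row; apply: submod_sum => // i _; case: sN => _ _; apply.
  exact: ND.
have homog_span d v : N v -> rhomog deg d v -> exists w, v = w *m D.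
  have [dB|Bd] := leP d B; first by move=> Nv hv; apply: spanD => //; exists d.
  have [j dE] : exists j : nat, d = B + j%:Z by exists `|d - B|%N; lia.
  move: v; rewrite dE {Bd dE}; elim: j => [|j IH] v Nv hv.
    by apply: spanD => //; exists B => //; move: hv; rewrite addr0.
  have [||_ l|z hz zE] := @koszul_exact K n r deg 0 (B + j.+1%:Z)
      (fun t => if t == set0 then v else 0).
  - move=> t; case: eqP => [->|_]; last exact: rhomog0.
    by rewrite cards0 subr0.
  - by [].
  - by rewrite eqxx; apply: mN.
  have vE : v = koszul z set0 by rewrite -zE ?cards0 ?eqxx.
  have [||w hw wE] := kvB _ hz; first by lia.
    by move=> t [/eqP]; rewrite cards_eq0 => /eqP ->; rewrite -vE.
  have {}vE : v = koszul (fun t => z t - koszul w t) set0 by rewrite koszulB koszulK subr0.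
  have /choose_fun[x hx] (k : 'I_n) : exists x, z (k |: set0) - koszul w (k |: set0) = x *m D.
    apply: IH; first by apply: wE; rewrite setU0 cards1.
    have -> : B + j%:Z = B + j.+1%:Z - #|k |: set0|%:Z by rewrite setU0 cards1; lia.
    exact: rhomogB (hz _) (homog_chain_koszul hw _).
  exists (\sum_(k | k \notin set0) koszul_coef K k set0 *: x k).
  by rewrite vE mulmx_suml; apply: eq_bigr => k _; rewrite hx scalemxAl.
exists r', deg', D; split=> // v; split=> [Nv|[w ->//]].
have [M ->] := rcomp_sum v.
have /choose_fun[x hx] (j : 'I_M) : exists x, rcomp deg (low + j%:Z) v = x *m D.
  by apply: homog_span; [apply: gN | apply: rcomp_homog].
by exists (\sum_j x j); rewrite mulmx_suml; apply: eq_bigr.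
Qed.

(** In a generating family with the least number of elements, a relation with a
    unit coefficient would express one generator through the others. *)
Lemma exists_minimal_generators : exists r' (deg' : 'I_r' -> int) D,
  [/\ graded_mx deg' deg D, forall v, N v <-> exists w, v = w *m D
    & forall u : 'rV[S]_r', u *m D = 0 -> in_irrelevant u].
Proof.
pose P r' := exists (deg' : 'I_r' -> int) D,
  graded_mx deg' deg D /\ forall v, N v <-> exists w, v = w *m D.
have [r' [[deg' [D [gD NE]]] rmin]] := least_nat (exists_generators : exists r', P r').
exists r', deg', D; split=> // v vD k; apply/eqP; apply: contraT => vk.
case: r' deg' D gD NE rmin v vD k vk => [|r'] deg' D gD NE rmin v vD k vk.
  by case: k {vk}.
suff /rmin : P r' by rewrite ltnn.
pose u := rcomp deg' (deg' k) v.
have uD : u *m D = 0.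
  by rewrite -(rcomp_mul _ _ gD) vD; apply/rowP => j; rewrite !mxE hcomp0.
pose c := (v 0 k)@_0%MM; have uk : u 0 k = c%:MP.
  apply/mpolyP => m; rewrite mxE mcoeff_mfilter mcoeffC subrr eqz_nat mdeg_eq0.
  by case: eqP => [->|_]; rewrite ?mulr1 ?mulr0.
have row'E (x : 'rV[S]_r'.+1) : x 0 k = 0 -> x *m D = col' k x *m row' k D.
  move=> xk; apply/rowP => j; rewrite !mxE (bigD1_ord k) //= xk mul0r add0r.
  by apply: eq_bigr => i _; rewrite !mxE.
exists (fun i => deg' (lift k i)), (row' k D); split=> [i j|v']; first by rewrite mxE; apply: gD.
split=> [/NE[w ->]|[w ->]].
  pose x := w - (w 0 k * (c^-1)%:MP) *: u; exists (col' k x); rewrite -row'E.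
    by rewrite mulmxBl -scalemxAl uD scaler0 subr0.
  have -> : x 0 k = w 0 k - w 0 k * (c^-1)%:MP * u 0 k by rewrite /x 3!mxE.
    by rewrite uk -mulrA -mpolyCM mulVf // mulr1 subrr.
apply/NE; exists (\row_i if unlift k i is Some j then w 0 j else 0).
rewrite row'E ?mxE ?unlift_none //; congr (_ *m _).
by apply/rowP => j; rewrite !mxE liftK.
Qed.
End Generators.
End Existence.

(** * Betti numbers and regularity of face rings *)

Section FaceRing.
Variables (K : fieldType) (n : nat) (D : pred {set 'I_n}).
Hypotheses (dD : down_closed D) (D0 : D set0).
Local Notation S := {mpoly K[n]}.
Variable I : S -> Prop.
Hypothesis IE : forall p, I p <-> nonface D p.
Implicit Types (d : int) (A : {set 'I_n}).

Lemma face_ideal_submodule : submodule (@face_ideal K n D).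
Proof.
split=> [m|v w hv hw m|p v hv m]; rewrite mxE ?mcoeff0 ?eqxx //.
  rewrite mcoeffD; have [->|/hv//] := eqVneq (v 0 0)@_m 0.
  by rewrite add0r; apply: hw.
rewrite -mcoeff_msupp => /msuppM_le /allpairsP[[m1 m2] /= [_ h2 ->]].
have := hv m2; rewrite -mcoeff_msupp => /(_ h2); apply: contraNN => /dD; apply.
by apply/subsetP => i; rewrite !inE mnmDE addn_gt0 => ->; rewrite orbT.
Qed.

Lemma face_ideal_graded : graded_sub (fun=> 0) (@face_ideal K n D).
Proof.
move=> d v hv m; rewrite mxE mcoeff_mfilter; case: ifP => _; rewrite ?eqxx //.
exact: hv.
Qed.

Lemma face_ideal_irrelevant v : @face_ideal K n D v -> in_irrelevant v.
Proof.
move=> hv l; rewrite ord1; apply/eqP; apply: contraT => /hv /negP[].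
by rewrite (_ : supp 0%MM = set0) //; apply/setP => i; rewrite !inE mnm0E.
Qed.

(** The state of the construction of a resolution.  The vanishing of Koszul
    homology in degrees above [n] passes from a module of relations to the next
    one and yields its finite generation. *)
Record syzygies := Syzygies {
  syz_rank : nat;
  syz_deg : 'I_syz_rank -> int;
  syz_mod : 'rV[S]_syz_rank -> Prop;
  syz_sub : submodule syz_mod;
  syz_graded : graded_sub syz_deg syz_mod;
  syz_irrelevant : forall v, syz_mod v -> in_irrelevant v;
  syz_koszul_acyclic : forall i d, n%:Z < d -> koszul_acyclic syz_deg syz_mod i d }.

Definition syz_step (Y : syzygies)
    (Z : {Y' : syzygies & 'M[S]_(syz_rank Y', syz_rank Y)}) :=
  [/\ graded_mx (@syz_deg (projT1 Z)) (@syz_deg Y) (projT2 Z),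
      forall v, @syz_mod Y v <-> exists w, v = w *m projT2 Z
    & forall v, @syz_mod (projT1 Z) v <-> v *m projT2 Z = 0].

Lemma exists_syz_step (Y : syzygies) : exists Z, @syz_step Y Z.
Proof.
have [r' [deg' [M [gM NE maxM]]]] := exists_minimal_generators (syz_sub Y) (@syz_graded Y)
  (@syz_irrelevant Y) (@syz_koszul_acyclic Y 1).
have M0 k l : (M k l)@_0%MM = 0.
  have := @syz_irrelevant Y (row k M); rewrite NE => /(_ _ l); rewrite mxE; apply.
  by exists (delta_mx 0 k); rewrite rowE.
have sN' : submodule (fun v => v *m M = 0).
  split=> [|v w e1 e2|p v e]; rewrite ?mul0mx ?mulmxDl ?e1 ?e2 ?addr0 //.
  by rewrite -scalemxAl e scaler0.
have gN' : graded_sub deg' (fun v => v *m M = 0).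
  move=> d v e; rewrite -(rcomp_mul _ _ gM) e.
  by apply/rowP => j; rewrite !mxE hcomp0.
have kN' i d : n%:Z < d -> koszul_acyclic deg' (fun v => v *m M = 0) i d.
  by move=> nd; apply/(koszul_acyclic_syzygies i d gM M0 NE (fun v => iff_refl _)); apply: syz_koszul_acyclic.
by exists (existT _ (Syzygies sN' gN' maxM kN') M).
Qed.

Lemma face_koszul_acyclic i d : n%:Z < d -> koszul_acyclic (fun=> 0) (@face_ideal K n D) i d.
Proof.
move=> nd; apply/(@koszul_acyclic_face K n D i d dD) => A cA _; move: nd; rewrite -cA ltz_nat => nA.
by have := max_card (mem A); rewrite card_ord leqNgt nA.
Qed.

Lemma face_resolution : exists F : gr_free_data K n,
  gr_free_resolution I F /\ gr_minimal F.
Proof.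
pose next Y := sval (constructive_indefinite_description _ (exists_syz_step Y)).
have nextP Y : syz_step (next Y).
  exact: svalP (constructive_indefinite_description _ (exists_syz_step Y)).
pose Y i := iter i (fun Y => projT1 (next Y))
  (Syzygies face_ideal_submodule face_ideal_graded face_ideal_irrelevant face_koszul_acyclic).
pose diff i : 'M[S]_(syz_rank (Y i.+1), syz_rank (Y i)) := projT2 (next (Y i)).
have YP i : syz_step (next (Y i)) := nextP (Y i).
exists (@GrFreeData K n (fun i => syz_rank (Y i)) (fun i => @syz_deg (Y i)) diff
  (const_mx 1 : 'cV[S]_1)).
have diff0 i k l : (diff i k l)@_0%MM = 0.
  have [_ NE _] := YP i; have := @syz_irrelevant (Y i) (row k (diff i)).
  rewrite NE => /(_ _ l); rewrite mxE; apply.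
  by exists (delta_mx 0 k); rewrite rowE.
split; last by move=> i k l; apply: diff0.
have augE (v : 'rV[S]_1) : (v *m const_mx 1) 0 0 = v 0 0.
  by rewrite mxE big_ord1 mxE mulr1.
split=> /=.
- split=> [k|i k l]; last by have [gM _ _] := YP i; apply: gM.
  by rewrite mxE => m; rewrite msupp1 inE => /eqP ->; rewrite mdeg0.
- move=> p; exists (const_mx p); rewrite augE mxE subrr; apply/IE => m.
  by rewrite mcoeff0 eqxx.
- by move=> v; rewrite augE IE; have [_ NE _] := YP 0%N; rewrite -NE.
move=> i v; have [_ _ NE'] := YP i; have [_ NE _] := YP i.+1.
by rewrite -[v *m _ = 0]NE' NE.
Qed.

(** Shifting homological degrees [i] times along the resolution turns the [i]-th
    Koszul homology of the face ring into the zeroth one of the [i]-th module,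
    which is spanned by the basis. *)
Lemma resolution_degreeP (F : gr_free_data K n) i d :
  gr_free_resolution I F -> gr_minimal F ->
  (exists k : 'I_(gr_rank F i), gr_deg k = d) <->
  ~ koszul_acyclic (fun=> 0) (@face_ideal K n D) i d.
Proof.
move=> [[haug hdiff] surj ker0 ker] minF.
pose N j (v : 'rV[S]_(gr_rank F j)) := exists w, v = w *m gr_diff F j.
have NE j v : N j v <-> exists w, v = w *m gr_diff F j by [].
have kv0 : koszul_acyclic (gr_deg (i := 0)) (N 0%N) i d <-> koszul_acyclic (fun=> 0) (@face_ideal K n D) i d.
  apply: (@koszul_acyclic_augment K n _ _ _ _ (gr_aug F)).
  - by move=> k l; rewrite subr0 ord1; apply: haug.
  - exact: face_ideal_submodule.
  - exact: face_ideal_graded.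
  - move=> p; have [v hv] := surj (p 0 0); exists v; apply/IE.
    by rewrite !mxE; rewrite mxE in hv.
  - by move=> v; rewrite /face_ideal -IE ker0.
have kvi j : (j <= i)%N ->
    koszul_acyclic (gr_deg (i := j)) (N j) (i - j) d <-> koszul_acyclic (gr_deg (i := 0)) (N 0%N) i d.
  elim: j => [|j IH] ji; first by rewrite subn0.
  rewrite -IH ?(ltnW ji) // -(subnSK ji).
  apply: iff_sym; apply: koszul_acyclic_syzygies (hdiff j) (minF j) (NE j) _ => v.
  by rewrite ker.
have := kvi i (leqnn i); rewrite subnn kv0 => <-; rewrite koszul_acyclic0; last 2 first.
- by exists 0; rewrite mul0mx.
- by move=> v [w ->]; apply: in_irrelevant_mul; apply: minF.
split=> [[k dk] h|h]; first exact: h dk.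
by apply: Classical_Prop.NNPP => nk; apply: h => k dk; apply: nk; exists k.
Qed.

Lemma betti_face i d : betti I i d <> 0%N <->
  exists A, [/\ #|A|%:Z = d, (i <= #|A|)%N & ~ std_acyclic K (induced D A) (#|A| - i)].
Proof.
pose P b := exists F : gr_free_data K n, [/\ gr_free_resolution I F, gr_minimal F
        & b = #|[set k : 'I_(gr_rank F i) | gr_deg k == d]|].
have Pb : P (betti I i d).
  apply: epsilon_spec; have [F [h1 h2]] := face_resolution.
  by exists #|[set k : 'I_(gr_rank F i) | gr_deg k == d]|, F.
have [F [resF minF ->]] := Pb; have := resolution_degreeP i d resF minF.
rewrite koszul_acyclic_face // => kv; split=> [nz|[A [cA iA nac]]].
  apply: Classical_Prop.NNPP => nA.
  have [x] : exists x, x \in [set k : 'I_(gr_rank F i) | gr_deg k == d].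
    by apply/set0Pn; apply: contra_notN nz => /eqP ->; rewrite cards0.
  rewrite inE => /eqP dx; apply: (kv.1 (ex_intro _ x dx)) => A cA iA.
  by apply: Classical_Prop.NNPP => nac; apply: nA; exists A.
have [|k dk] := kv.2; first by move=> h; apply: nac; apply: h.
by apply/eqP; rewrite cards_eq0; apply/set0Pn; exists k; rewrite inE dk.
Qed.

Lemma reg_quot_face q : reg_le K D setT q ->
  (exists A, ~ std_acyclic K (induced D A) q) -> reg_quot I = q%:Z.
Proof.
move=> upper [A nA].
have cardA : (q <= #|A|)%N.
  rewrite leqNgt; apply/negP => Aq; apply: nA => c _; exists (fun=> 0) => F /andP[_].
  by move=> /subset_leq_card FA cF; move: Aq; rewrite -cF ltnNge FA.
pose P (r : int) := (exists (i : nat) (j : int), betti I i j <> 0%N /\ r = j - i%:Z)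
    /\ forall (i : nat) (j : int), betti I i j <> 0%N -> j - i%:Z <= r.
have Pq : P q%:Z.
  split; first exists (#|A| - q)%N, #|A|%:Z; first split.
  - by apply/betti_face; exists A; split=> //; rewrite ?leq_subr ?subKn.
  - by lia.
  move=> i j /betti_face[A' [<- iA' nA']]; rewrite leNgt; apply/negP => qA'.
  by apply: nA'; apply: upper; rewrite ?subsetT //; lia.
have [[i [j [bij e]]] maxr] : P (reg_quot I) by apply: epsilon_spec; exists q%:Z.
have [[i' [j' [bij' e']]] max'] := Pq.
apply/eqP; rewrite eq_le; apply/andP; split; first by rewrite e max'.
by rewrite e' maxr.
Qed.
End FaceRing.

(** * Disjoint families of induced subgraphs *)

Section RegMore.
Variables (K : fieldType) (T : finType).
Implicit Types (D : pred {set T}) (A B F : {set T}) (p q : nat).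

Lemma reg_le_leq D A p q : (p <= q)%N -> reg_le K D A p -> reg_le K D A q.
Proof. by move=> pq rA B r BA qr; apply: rA => //; apply: leq_ltn_trans qr. Qed.

Lemma not_acyclic_set0 D : D set0 -> ~ std_acyclic K (induced D set0) 0.
Proof.
move=> D0 ac; have [|w /(_ set0)] := ac (fun=> 1).
  by move=> F /andP[_]; rewrite subset0 => /eqP ->; rewrite cards0.
rewrite /induced D0 sub0set cards0 => /(_ isT erefl) /eqP.
by rewrite /coboundary big_set0 oner_eq0.
Qed.

Lemma std_acyclic_large D A q : (#|A| < q)%N -> std_acyclic K (induced D A) q.
Proof.
move=> Aq c _; exists (fun=> 0) => F /andP[_ /subset_leq_card FA] cF.
by move: Aq; rewrite -cF ltnNge FA.
Qed.

Lemma exists_reg D : D set0 ->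
  exists q, reg_le K D setT q /\ exists A, ~ std_acyclic K (induced D A) q.
Proof.
move=> D0; have [|p [pr pmin]] := @least_nat (fun q => reg_le K D setT q).
  by exists #|T| => B q _ Tq; apply: std_acyclic_large; apply: leq_ltn_trans (max_card _) Tq.
exists p; split=> //; case: p => [|p] in pr pmin *.
  by exists set0; apply: not_acyclic_set0.
apply: Classical_Prop.NNPP => nA; suff /pmin : reg_le K D setT p by rewrite ltnn.
move=> B q BT pq; have [e|ne] := eqVneq q p.+1; last by apply: pr => //; lia.
by apply: Classical_Prop.NNPP => nB; apply: nA; exists B; rewrite -e.
Qed.
End RegMore.

Lemma reg_le_imset (K : fieldType) (T T' : finType) (f : T -> T')
    (D : pred {set T}) (D' : pred {set T'}) (A : {set T}) p :
  injective f -> (forall F : {set T}, D F = D' (f @: F)) ->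
  reg_le K D A p -> reg_le K D' (f @: A) p.
Proof.
move=> f_inj eD rA B q BfA pq.
have -> : B = f @: (f @^-1: B).
  apply/setP=> y; apply/idP/imsetP => [yB|[x]]; last by rewrite inE => xB ->.
  case/imsetP: (subsetP BfA y yB) => x xA ey.
  by exists x; rewrite // inE -ey.
apply/(std_acyclic_imset K _ _ f_inj eD)/rA => //; apply/subsetP => x; rewrite inE => xB.
by rewrite -(mem_imset _ _ f_inj) (subsetP BfA).
Qed.

Section Family.
Variables (K : fieldType) (T I : finType) (e : rel T).
Hypotheses (e_sym : ssrbool.symmetric e) (e_irr : irreflexive e).
Variable B : I -> {set T}.
Implicit Types (W : {set I}) (F : {set T}).

Let separated (W : {set I}) :=
  {in W &, forall i j, i != j -> [disjoint B i & B j] /\ {in B i & B j, forall x y, ~~ e x y}}.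

Lemma family_split W i : i \in W -> separated W ->
  [/\ \bigcup_(j in W) B j = B i :|: \bigcup_(j in W :\ i) B j,
      [disjoint B i & \bigcup_(j in W :\ i) B j], separated (W :\ i)
    & forall F, F \subset B i :|: \bigcup_(j in W :\ i) B j -> indep e F
        = indep e (F :&: B i) && indep e (F :&: \bigcup_(j in W :\ i) B j)].
Proof.
move=> iW sW; have sub j : j \in W :\ i -> j \in W /\ i != j.
  by rewrite !inE eq_sym => /andP[].
split.
- by rewrite (big_setD1 i).
- rewrite disjoint_sym disjoints_subset; apply/bigcupsP => j /sub[jW nij].
  by rewrite -disjoints_subset disjoint_sym; have [] := sW i j iW jW nij.
- by move=> j k /sub[jW _] /sub[kW _]; apply: sW.
move=> F; apply: indep_join => // x y xi /bigcupP[j /sub[jW nij] yj].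
by have [_] := sW i j iW jW nij; apply.
Qed.

Lemma reg_le_family W q : separated W -> (forall i, i \in W -> reg_le K (indep e) (B i) q) ->
  reg_le K (indep e) (\bigcup_(i in W) B i) (#|W| * q).
Proof.
move: {2}#|W| (erefl #|W|) => m; elim: m W => [|m IH] W cW sW rW.
  have W0 : W = set0 by apply/eqP; rewrite -cards_eq0 cW.
  by rewrite W0 big_set0 cards0; apply: reg_le_edgeless => // x y; rewrite inE.
have [i iW] : exists i, i \in W by apply/set0Pn; rewrite -cards_eq0 cW.
have [-> dB sW' jB] := family_split iW sW.
have cWi : #|W :\ i| = m by move: cW; rewrite (cardsD1 i) iW => -[].
rewrite (cardsD1 i W) iW mulSn; apply: reg_le_join => //; [exact: indep_down|exact: rW|].
by apply: IH => // j; rewrite inE => /andP[_]; apply: rW.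
Qed.

Lemma not_acyclic_family W q : separated W -> (forall i, i \in W -> ~ std_acyclic K (induced (indep e) (B i)) q) ->
  ~ std_acyclic K (induced (indep e) (\bigcup_(i in W) B i)) (#|W| * q).
Proof.
move: {2}#|W| (erefl #|W|) => m; elim: m W => [|m IH] W cW sW rW.
  have W0 : W = set0 by apply/eqP; rewrite -cards_eq0 cW.
  rewrite W0 big_set0 cards0; apply: not_acyclic_set0.
  by apply/indepP => x y; rewrite inE.
have [i iW] : exists i, i \in W by apply/set0Pn; rewrite -cards_eq0 cW.
have [-> dB sW' jB] := family_split iW sW.
have cWi : #|W :\ i| = m by move: cW; rewrite (cardsD1 i) iW => -[].
rewrite (cardsD1 i W) iW mulSn; apply: not_acyclic_join => //; first exact: rW.
by apply: IH => // j; rewrite inE => /andP[_]; apply: rW.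
Qed.
End Family.

(** * The regularity of an edge ideal *)

Section EdgeIdeal.
Variables (K : fieldType) (G : sgraph).
Implicit Types (A F : {set G}) (x y : G).
Local Notation n := #|G|.
Local Notation S := {mpoly K[n]}.

(** The Stanley-Reisner complex of the edge ideal: isolated vertices are not
    even vertices of it, as they are among the generators. *)
Definition graph_face : pred {set G} :=
  fun F => indep (@adj G) F && [forall x in F, ~~ isolated x].

Definition var_face : pred {set 'I_n} :=
  fun F : {set 'I_n} => graph_face (enum_val @: F).

Lemma graph_face_down : down_closed graph_face.
Proof.
move=> F F' /andP[iF /forall_inP nF] sF; rewrite /graph_face (indep_down iF sF) /=.
by apply/forall_inP => x xF; apply: nF; apply: (subsetP sF).
Qed.

Lemma graph_face0 : graph_face set0.
Proof.
by apply/andP; split; [apply/indepP => x y|apply/forall_inP => x]; rewrite inE.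
Qed.

Lemma edge_idealE (p : S) : @edge_ideal K G p <-> nonface var_face p.
Proof.
have mem_supp x (m : 'X_{1..n}) : (0 < m (enum_rank x))%N -> x \in enum_val @: supp m.
  by move=> mx; apply/imsetP; exists (enum_rank x); rewrite ?enum_rankK // inE.
split=> [[s [gen ->]] m|h].
  rewrite raddf_sum /= => nz.
  have [u us um] : exists2 u, u \in s & (u.1 * u.2)@_m != 0.
    apply: Classical_Prop.NNPP => nu; case/eqP: nz; rewrite big_seq big1 // => u us.
    by apply/eqP; apply: contraT => um; case: nu; exists u.
  move: um; rewrite -mcoeff_msupp => /msuppM_le /allpairsP[[m1 m2] /= [_ m2u ->]].
  case: (gen u us) => [[x [y [exy u2]]]|[x [ix u2]]]; move: m2u; rewrite u2 /vvar.
    rewrite -mpolyXD msuppX inE => /eqP ->; apply/negP => /andP[/indepP ind _].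
    have := ind x y; rewrite !mem_supp ?mnmDE ?mnm1E ?eqxx ?orbT ?addn_gt0 ?orbT //.
    by rewrite exy => /(_ isT isT).
  rewrite msuppX inE => /eqP ->; apply/negP => /andP[_ /forall_inP ind].
  have := ind x; rewrite ix mem_supp ?mnmDE ?mnm1E ?eqxx ?addn_gt0 ?orbT //.
  by move=> /(_ isT).
have /choose_fun[g hg] (m : 'X_{1..n}) : exists u : S * S, m \in msupp p ->
    ((exists x y : G, adj x y /\ u.2 = vvar K x * vvar K y)
    \/ (exists x : G, isolated x /\ u.2 = vvar K x)) /\ 'X_[m] = u.1 * u.2.
  have [mp|_] := boolP (m \in msupp p); last by exists (0, 0).
  have := h m; rewrite -mcoeff_msupp => /(_ mp); rewrite negb_and => /orP[|].
    case/forall_inPn => x /imsetP[a am ex] /forall_inPn[y /imsetP[b bm ey]].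
    rewrite negbK => exy; exists ('X_[m - U_(a) - U_(b)], 'X_a * 'X_b) => _; split.
      by left; exists x, y; split=> //; rewrite /vvar ex ey !enum_valK.
    rewrite /= -!mpolyXD; congr 'X_[_]; apply/mnmP => j; rewrite !mnmDE !mnmBE !mnm1E.
    have nab : a != b by apply: contraTneq exy => eab; rewrite ex ey eab adj_irr.
    move: am bm nab; rewrite !inE => am bm nab.
    have [ea|_] := eqVneq a j; last by have [<-|_] := eqVneq b j; rewrite !subn0 ?subn1 ?addn0 //= ?add0n ?addn1 ?prednK.
    rewrite -ea [b == a]eq_sym (negPf nab) /= subn0 addn0 subn1 addn1 prednK //.
  case/forall_inPn => x /imsetP[a am ex]; rewrite negbK => ix.
  exists ('X_[m - U_(a)], 'X_a) => _; split.
    by right; exists x; split=> //; rewrite /vvar ex enum_valK.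
  rewrite /= -mpolyXD; congr 'X_[_]; apply/mnmP => j; rewrite !mnmDE !mnmBE !mnm1E.
  by move: am; rewrite inE; case: (eqVneq a j) => [<-|_] am; rewrite ?subn1 ?addn1 ?prednK ?subn0 ?addn0.
exists [seq (p@_m *: (g m).1, (g m).2) | m <- msupp p]; split.
  by move=> _ /mapP[m mp ->] /=; have [] := hg m mp.
rewrite big_map [LHS]mpolyE big_seq [RHS]big_seq; apply: eq_bigr => m mp /=.
by rewrite -scalerAl; have [_ <-] := hg m mp.
Qed.

Lemma induced_graph_face A :
  induced graph_face A =1 induced (indep (@adj G)) [set x in A | ~~ isolated x].
Proof.
move=> F; rewrite /induced /graph_face -andbA; congr (_ && _).
apply/andP/subsetP => [[/forall_inP nF /subsetP FA] x xF|h].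
  by rewrite inE FA ?nF.
split; first by apply/forall_inP => x /h; rewrite inE => /andP[].
by apply/subsetP => x /h; rewrite inE => /andP[].
Qed.

(** A set of vertices whose independence complex has cohomology contains no
    vertex isolated in [G], so the complex of the edge ideal and the independence
    complex have cohomology on faces of the same sizes. *)
Lemma reg_edge_ideal q : reg_le K (indep (@adj G)) setT q ->
  (exists A : {set G}, ~ std_acyclic K (induced (indep (@adj G)) A) q) ->
  reg_quot (@edge_ideal K G) = q%:Z.
Proof.
move=> rG [A nA].
have imF (F : {set 'I_n}) : var_face F = graph_face (enum_val @: F) by [].
have acE (B : {set 'I_n}) r : std_acyclic K (induced var_face B) r <->
    std_acyclic K (induced (indep (@adj G)) [set x in enum_val @: B | ~~ isolated x]) r.
  rewrite (std_acyclic_imset K B r enum_val_inj imF); split; apply: eq_acyclic => F.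
    exact: induced_graph_face.
  by rewrite induced_graph_face.
apply: (reg_quot_face (D := var_face)).
- by move=> F F' fF sF; apply: graph_face_down fF _; apply: imsetS.
- by rewrite /var_face imset0 graph_face0.
- exact: edge_idealE.
- by move=> B r _ qr; apply/acE/rG; rewrite ?subsetT.
exists (enum_rank @: A); rewrite acE (_ : [set x in _ | _] = A) //.
apply/setP => x; rewrite inE.
have -> : (x \in enum_val @: (enum_rank @: A)) = (x \in A).
  apply/imsetP/idP => [[_ /imsetP[y yA ->] ->]|xA]; first by rewrite enum_rankK.
  by exists (enum_rank x); rewrite ?imset_f ?enum_rankK.
have [xA|] //= := boolP (x \in A).
apply/negP => /forallP ix; apply: nA.
have nx : {in A, forall y, ~~ adj x y} by move=> y _; apply: ix.
exact: (std_acyclic_isolated (@adj_sym G) (@adj_irr G) xA nx).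
Qed.
End EdgeIdeal.

(** * Corona products *)

Section Corona.
Variables (K : fieldType) (X H : sgraph).
Local Notation C := (corona X H).
Implicit Types (x y : X) (h k : H) (U W : {set X}) (A : {set H}).

Definition copy x h : C := inr (x, h).

Lemma copy_inj x : injective (copy x).
Proof. by move=> h k []. Qed.

Lemma indep_imset (T T' : finType) (e : rel T) (e' : rel T') (f : T -> T') :
  (forall a b, e' (f a) (f b) = e a b) ->
  forall F : {set T}, indep e F = indep e' (f @: F).
Proof.
move=> fe F; apply/indepP/indepP => h a b.
  by case/imsetP=> c cF -> /imsetP[d dF ->]; rewrite fe h.
by move=> aF bF; rewrite -fe h // imset_f.
Qed.

Lemma indep_copy x (F : {set H}) : indep (@adj H) F = indep (@adj C) (copy x @: F).
Proof. by apply: indep_imset => h k; rewrite /= eqxx. Qed.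

Lemma copies_separated (A : {set H}) x y : x != y ->
  [disjoint copy x @: A & copy y @: A] /\
  {in copy x @: A & copy y @: A, forall u v, ~~ @adj C u v}.
Proof.
move=> nxy; split; last first.
  by move=> _ _ /imsetP[h _ ->] /imsetP[k _ ->] /=; rewrite (negPf nxy).
apply/pred0P => u /=; apply/negP => /andP[/imsetP[h _ ->] /imsetP[k _ []] exy _].
by rewrite exy eqxx in nxy.
Qed.

Definition corona_part U W : {set C} :=
  [set u : C | match u with inl x => x \in U | inr (x, _) => x \in W end].

Lemma copies_part W : \bigcup_(x in W) (copy x @: setT) = corona_part set0 W.
Proof.
apply/setP => u; apply/bigcupP/idP => [[x xW /imsetP[h _ ->]]|]; first by rewrite inE.
rewrite inE; case: u => [x|[x h]]; first by rewrite inE.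
by move=> xW; exists x => //; apply: imset_f.
Qed.

(** Deleting [x] in [U] keeps all the copies of [H]; passing to its link costs
    one unit but loses the copy attached to [x], which is worth [r >= 1]. *)
Lemma reg_le_corona r U W : (0 < r)%N -> reg_le K (indep (@adj H)) setT r ->
  U \subset W -> reg_le K (indep (@adj C)) (corona_part U W) (#|W| * r).
Proof.
move=> r0 rH; move: {2}#|U| (erefl #|U|) => m; elim: m U W => [|m IH] U W cU UW.
  have -> : U = set0 by apply/eqP; rewrite -cards_eq0 cU.
  rewrite -copies_part; apply: reg_le_family; [exact: adj_sym|exact: adj_irr| |].
    by move=> x y _ _; apply: copies_separated.
  by move=> x _; apply: reg_le_imset rH; [apply: copy_inj|apply: indep_copy].
have [x xU] : exists x, x \in U by apply/set0Pn; rewrite -cards_eq0 cU.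
have cUx : #|U :\ x| = m by move: cU; rewrite (cardsD1 x) xU => -[].
have xW := subsetP UW x xU.
(* the link is allowed r - 1 units more than its copies of H use *)
have -> : (#|W| * r = (#|W :\ x| * r + r.-1).+1)%N.
  by rewrite (cardsD1 x) xW mulSn -addnS prednK // addnC.
apply: (@reg_le_del_link K C (@adj C) (@adj_sym C) (@adj_irr C) _ (inl x)).
  apply: (@reg_le_leq _ _ _ _ (#|W| * r)).
    by rewrite (cardsD1 x) xW mulSn -addnS prednK // addnC.
  apply: reg_le_sub (IH (U :\ x) W cUx _); last first.
    by apply: subset_trans UW; rewrite subsetDl.
  by apply/subsetP => -[y|[y h]]; rewrite !inE // => /andP[-> ->].
apply: (@reg_le_leq _ _ _ _ (#|W :\ x| * r)); first by rewrite leq_addr.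
apply: reg_le_sub (IH (U :\ x) (W :\ x) cUx (setSD _ UW)).
apply/subsetP => -[y|[y h]]; rewrite !inE /=.
  by case/and3P=> _ nyx ->; rewrite andbT; apply: contraNneq nyx => ->.
by rewrite eq_sym.
Qed.

Lemma not_acyclic_corona r A : ~ std_acyclic K (induced (indep (@adj H)) A) r ->
  ~ std_acyclic K (induced (indep (@adj C)) (\bigcup_(x in [set: X]) copy x @: A)) (#|X| * r).
Proof.
move=> nA; rewrite -cardsT; apply: not_acyclic_family.
- exact: adj_sym.
- by move=> x y _ _; apply: copies_separated.
by move=> x _; rewrite -(std_acyclic_imset K A r (@copy_inj x) (indep_copy x)).
Qed.

(** The lower bound comes from the induced subgraph formed by the copies of a
    vertex set of [H] that realizes its regularity. *)
Lemma reg_corona_edge r : ~~ null_graph H -> reg_le K (indep (@adj H)) setT r ->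
  (exists A, ~ std_acyclic K (induced (indep (@adj H)) A) r) ->
  reg_quot (@edge_ideal K C) = (#|X| * r)%:Z.
Proof.
move=> nH rH [A nA].
have [h [k ehk]] : exists h k : H, adj h k.
  by case/forallPn: nH => h /forallPn[k]; rewrite negbK; exists h, k.
have r0 : (0 < r)%N.
  rewrite lt0n; apply/eqP => r0; rewrite r0 in rH.
  by apply: (not_acyclic_edge (@adj_irr H) ehk (K := K)); apply: rH; rewrite ?subsetT.
apply: reg_edge_ideal.
  rewrite -cardsT (_ : setT = corona_part setT setT).
    exact: reg_le_corona.
  by apply/setP => -[x|[x y]]; rewrite !inE.
by eexists; apply: not_acyclic_corona nA.
Qed.
End Corona.

(** * Whiskered paths *)

Section WhiskeredPath.
Variables (K : fieldType) (n : nat) (H : sgraph).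
Hypothesis nullH : null_graph H.
Local Notation C := (corona (path_graph n) H).

Lemma null_adj (h k : H) : adj h k = false.
Proof. by apply/negbTE; move/forallP/(_ h)/forallP/(_ k): nullH. Qed.

Definition path_part (m : nat) : {set C} :=
  corona_part H [set i : path_graph n | (i < m)%N] setT.

(** The link of the last vertex of the path contains neither this vertex nor the
    previous one, hence costs one unit for two vertices. *)
Lemma reg_le_path_part m : (m <= n)%N ->
  reg_le K (indep (@adj C)) (path_part m) (uphalf m).
Proof.
elim/ltn_ind: m => -[|m] IH mn.
  apply: reg_le_edgeless; [exact: adj_sym|exact: adj_irr|].
  by move=> [i|[i h]] [j|[j k]]; rewrite !inE //= null_adj andbF.
pose i : path_graph n := Ordinal mn.
have -> : uphalf m.+1 = m./2.+1 by [].
apply: (@reg_le_del_link K C (@adj C) (@adj_sym C) (@adj_irr C) _ (inl i)).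
  apply: (@reg_le_leq _ _ _ _ (uphalf m)); first by rewrite uphalf_half; case: (odd m).
  apply: reg_le_sub (IH m (ltnSn m) (ltnW mn)).
  apply/subsetP => -[j|[j h]]; rewrite !inE //= => /andP[nji].
  rewrite ltnS leq_eqVlt => /orP[/eqP ejm|//].
  by case/eqP: nji; congr inl; apply: val_inj.
have -> : m./2 = uphalf m.-1 by case: (m).
apply: reg_le_sub (IH m.-1 _ _); [|by rewrite ltnS leq_pred|].
  apply/subsetP => -[j|[j h]]; rewrite !inE //= => /and3P[nij nji].
  rewrite ltnS leq_eqVlt => /orP[/eqP ejm|jm].
    by case/eqP: nji; congr inl; apply: val_inj.
  move: nij; rewrite /path_adj /= negb_or => /andP[_]; lia.
exact: leq_trans (leq_pred m) (ltnW mn).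
Qed.

Lemma card_even : #|[set i : 'I_n | ~~ odd i]| = uphalf n.
Proof.
rewrite -sum1dep_card big_mkcond; elim: (n) => [|m IH]; first by rewrite big_ord0.
rewrite big_ord_recr /= IH uphalf_half /=; case: (odd m) => /=; lia.
Qed.

(** The bound is attained on the induced matching formed by one whisker at each
    even position of the path. *)
Lemma reg_whiskered_path (h : H) : reg_quot (@edge_ideal K C) = (uphalf n)%:Z.
Proof.
apply: reg_edge_ideal.
  apply: reg_le_sub (reg_le_path_part (leqnn n)).
  by apply/subsetP => -[i|[i k]] _; rewrite !inE.
pose B (i : path_graph n) : {set C} := [set inl i; inr (i, h)].
exists (\bigcup_(i in [set i : 'I_n | ~~ odd i]) B i).
rewrite -card_even -[#|_|]muln1; apply: not_acyclic_family.
- exact: adj_sym.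
- move=> i j; rewrite !inE => oi oj nij; split.
    apply/pred0P => u /=; rewrite !inE; apply/negP => /andP[].
    by case/orP=> /eqP -> /orP[] /eqP // [e]; rewrite e eqxx in nij.
  move=> u v; rewrite !inE => /orP[]/eqP -> /orP[]/eqP -> /=; rewrite ?(negPf nij) //.
  apply/negP => /orP[]/eqP e; [move: oj | move: oi].
    by rewrite -e /= (negPf oi).
  by rewrite -e /= (negPf oj).
by move=> i _; apply: not_acyclic_edge; [exact: adj_irr|rewrite /= eqxx].
Qed.
End WhiskeredPath.

Theorem theorem2p28 (K : fieldType) (n : nat) (H : sgraph)
    (hn : (1 <= n)%N) (hH : (0 < #|H|)%N) :
  reg_quot (@edge_ideal K (corona (path_graph n) H)) =
    if null_graph H then (uphalf n)%:Z
    else n%:Z * reg_quot (@edge_ideal K H).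
Proof.
have [h _] : exists h : H, h \in H by apply/card_gt0P.
case: ifPn => [nullH|edgeH]; first exact: reg_whiskered_path nullH h.
have [|r [rH nH]] := @exists_reg K H (indep (@adj H)).
  by apply/indepP => x y; rewrite inE.
by rewrite (reg_corona_edge _ edgeH rH nH) (reg_edge_ideal rH nH) card_ord PoszM.
Qed.
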